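(* There is a constant $C>0$ such that, with probability $1-o(1)$ as $n\to\infty$ over $G\leftarrow G(n,1/2)$, the system $\mathrm{Clique}(G,k)$ has no $\mathsf{PS}(r)$ refutation for $k\le \dfrac{n^{1/(2r)}}{C^{r}(\log n)^{1/r}}$.
   Context: $G(n,1/2)$ is the random graph on vertex set $[n]$ with each pair an edge independently with probability $1/2$. For a graph $G$ on $[n]$ and $k$, $\mathrm{Clique}(G,k)$ is the system of polynomial axioms in variables $x_1,\dots,x_n$: $x_i^2-x_i=0$ for all $i\in[n]$; $x_ix_j=0$ for every pair $\{i,j\}$ that is not an edge of $G$; and $\sum_i x_i-k=0$. Given axioms $f_1,\dots,f_m$ (real $n$-variate polynomials), a positivstellensatz refutation of degree $r$ ($\mathsf{PS}(r)$ refutation) is an identity $\sum_{i=1}^m f_ig_i\equiv 1+\sum_{j=1}^N h_j^2$ of polynomials, where $g_i,h_j$ are real $n$-variate polynomials with $\deg(f_ig_i)\le 2r$ for all $i$ and $\deg(h_j)\le r$ for all $j$. *)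

(* Defs.v *)
From HB Require Import structures.
From mathcomp Require Import all_boot all_order all_algebra.
From mathcomp Require Import mpoly.
From mathcomp Require Import boolp reals.

Set Implicit Arguments.
Unset Strict Implicit.
Unset Printing Implicit Defensive.

Import Order.TTheory GRing.Theory Num.Theory.
Local Open Scope ring_scope.

(* A simple graph on the vertex set 'I_n is its set of edges, that is, a
   subset of [vpairs n]. *)
Definition vpairs (n : nat) : {set {set 'I_n}} := [set e : {set 'I_n} | #|e| == 2%N].

(* The event is a Prop-valued predicate, since the existence of a refutation
   is not decidable by computation. *)
Definition Gnp_prob (R : realType) (n : nat) (p : R)
    (A : {set {set 'I_n}} -> Prop) : R :=
  \sum_(G in powerset (vpairs n) | `[< A G >])
    \prod_(e in vpairs n) (if e \in G then p else 1 - p).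

(* Total degree at most d; [msize q] is deg q + 1, and 0 for q = 0. *)
Definition mdeg_le (R : realType) (n d : nat) (q : {mpoly R[n]}) : Prop :=
  (msize q <= d.+1)%N.

Definition PS_refutation (R : realType) (n r : nat)
    (f : seq {mpoly R[n]}) : Prop :=
  exists (g : 'I_(size f) -> {mpoly R[n]}) (h : seq {mpoly R[n]}),
    [/\ forall i : 'I_(size f), mdeg_le (2 * r) (f`_i * g i),
        forall q, q \in h -> mdeg_le r q &
        \sum_(i < size f) f`_i * g i = 1 + \sum_(q <- h) q ^+ 2].

Definition Clique (R : realType) (n : nat) (G : {set {set 'I_n}}) (k : nat) :
    seq {mpoly R[n]} :=
  [seq 'X_i ^+ 2 - 'X_i | i <- enum 'I_n]
  ++ [seq 'X_(ij.1) * 'X_(ij.2) |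
       ij <- enum [pred ij : 'I_n * 'I_n |
                    (ij.1 < ij.2)%N && ([set ij.1; ij.2] \notin G)]]
  ++ [:: \sum_(i < n) 'X_i - k%:R].
Arguments Clique R {n} G k.

(* Main.v *)
Require Import Defs.
From mathcomp Require Import all_boot all_order all_algebra.
From mathcomp Require Import ring lra zify.
From mathcomp Require Import boolp reals polyrcf.
From mathcomp Require mpoly.

(** A refutation is excluded by a pseudo-expectation: a linear functional that
    vanishes on the multiples of the axioms and is nonnegative on squares.  As
    usual, [E(x_I)] is proportional to the weighted number of 2r-cliques
    containing [I]; it is computed downwards from the indicator of 2r-cliques so
    that the axiom on the sum of the variables holds by construction.

    Positivity is only needed on homogeneous multilinear polynomials of degree
    [r].  For r-cliques [I], [J] the entry [E(x_(I u J))] is close to a weight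
    depending on [|I n J|] times the indicator that all edges between [I \ J] and
    [J \ I] are present.  Replacing each edge indicator by [(1 + t chi)/2] and
    differentiating in [t] pulls out a single factor [chi u v]; all the other
    factors split into a function of [u] and a function of [v], so a bound
    [O(sqrt n log n)] on the n x n sign matrix [chi] controls the difference
    between [t = 1] and [t = 0].  At [t = 0] the form lies in the Johnson scheme
    and is a nonnegative combination of squares [(sum_(I >= A) g_I)^2], because
    the weights grow quickly with [|I n J|].

    Two properties of the random graph suffice: every small set of vertices has
    about the expected number of common neighbours, and the bilinear form of
    [chi] is bounded.  Both follow from subgaussian tails and a union bound, the
    second one over a grid of vectors; the loss of a logarithm is affordable. *)

Set Implicit Arguments.
Unset Strict Implicit.
Unset Printing Implicit Defensive.

Import Order.TTheory GRing.Theory Num.Theory.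
Local Open Scope ring_scope.

(** * From pseudo-expectations to the absence of refutations *)

(** Möbius inversion on the lattice of subsets, from large sets down: [c I] is what remains of [E I]
    after the strictly larger sets are subtracted. It represents any function of variable sets by
    evaluations at 0/1 points. *)
Lemma superset_sum_inversion (R : zmodType) (T : finType) (E : {set T} -> R) :
  exists c : {set T} -> R, forall I : {set T}, E I = \sum_(S : {set T} | I \subset S) c S.
Proof.
suff [c Hc] : exists c : {set T} -> R, forall I : {set T}, (#|T| - #|I| < #|T|.+1)%N ->
    E I = \sum_(S : {set T} | I \subset S) c S.
  by exists c => I; apply: Hc; rewrite ltnS leq_subr.
elim: #|T|.+1 => [|d [c Hc]]; first by exists (fun=> 0).
pose c' (S : {set T}) := if (#|T| - #|S| < d)%N then c S
             else E S - \sum_(U : {set T} | S \proper U) c U.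
exists c' => I; rewrite ltnS leq_eqVlt => /orP[/eqP dI|dI].
  rewrite (bigD1 I) //= {1}/c' dI ltnn.
  rewrite [X in _ = _ + X](_ : _ = \sum_(U : {set T} | I \proper U) c U) ?subrK //.
  apply: eq_big => [S|S /andP[sIS neIS]]; first by rewrite properEneq eq_sym andbC.
  have: (#|I| < #|S|)%N by apply: proper_card; rewrite properEneq eq_sym neIS.
  by rewrite /c' => cIS; rewrite ifT //; have := subset_leq_card (subsetT S); rewrite cardsT; lia.
rewrite Hc //; apply: eq_bigr => S sIS.
by rewrite /c' ifT //; have := subset_leq_card sIS; lia.
Qed.

Module Mpoly.
Import mpoly.

Definition msupport (n : nat) (m : 'X_{1..n}) : {set 'I_n} := [set i | m i != 0%N].

Lemma card_msupport (n : nat) (m : 'X_{1..n}) : (#|msupport m| <= mdeg m)%N.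
Proof.
rewrite mdegE -sum1_card big_mkcond; apply: leq_sum => i _.
by rewrite inE; case: (m i).
Qed.

(** The coefficient of [x_I] in the multilinear reduction of [p], that is, modulo all
    [x_i ^ 2 - x_i]. *)
Definition set_coef (R : realType) (n : nat) (p : {mpoly R[n]}) (I : {set 'I_n}) : R :=
  \sum_(m <- msupp p | msupport m == I) p@_m.

Definition ind (R : realType) (n : nat) (S : {set 'I_n}) (i : 'I_n) : R := (i \in S)%:R.

Lemma meval_ind (R : realType) (n : nat) (p : {mpoly R[n]}) (S : {set 'I_n}) :
  p.@[ind R S] = \sum_(I : {set 'I_n}) set_coef p I * (I \subset S)%:R.
Proof.
rewrite mevalE (partition_big (@msupport n) predT) //=.
apply: eq_bigr => I _; rewrite /set_coef mulr_suml; apply: eq_bigr => m /eqP mI.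
congr (_ * _); case: (boolP (I \subset S)) => [/subsetP sIS|/subsetPn[i iI iS]].
  rewrite big1 // => i _; rewrite /ind.
  have := sIS i; rewrite -mI inE; case: eqP => [-> _|_ /(_ isT) ->]; first by rewrite expr0.
  by rewrite expr1n.
rewrite (bigD1 i) //= /ind (negPf iS); move: iI; rewrite -mI inE => mi.
by rewrite expr0n (negPf mi) mul0r.
Qed.

Lemma set_coef_eq0 (R : realType) (n d : nat) (p : {mpoly R[n]}) (I : {set 'I_n}) :
  (msize p <= d.+1)%N -> (d < #|I|)%N -> set_coef p I = 0.
Proof.
move=> pd dI; rewrite /set_coef big_seq_cond big1 // => m /andP[mp /eqP mI].
have := msize_mdeg_lt mp; have := card_msupport m; rewrite mI.
move: pd dI; lia.
Qed.

(* The functional sends a monomial with variable set [I] to [E I]; it is a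
   combination of evaluations at indicator vectors. *)
Lemma no_refutation (R : realType) (n r k : nat) (G : {set {set 'I_n}})
    (E : {set 'I_n} -> R) :
  (0 < r)%N -> (0 < n)%N ->
  0 < E set0 ->
  (forall (I : {set 'I_n}) i j, i \in I -> j \in I -> i != j -> [set i; j] \notin G -> E I = 0) ->
  (forall K : {set 'I_n}, (#|K| < 2 * r)%N -> \sum_v E (v |: K) = k%:R * E K) ->
  (forall F : {set 'I_n} -> R, (forall I : {set 'I_n}, (r < #|I|)%N -> F I = 0) ->
     0 <= \sum_I \sum_J F I * F J * E (I :|: J)) ->
  ~ PS_refutation r (Clique R G k).
Proof.
move=> r0 n0 E0 Ecl Elin Epsd [g [h [dg dh eq_gh]]].
have [c Hc] := superset_sum_inversion E.
pose L (p : {mpoly R[n]}) := \sum_(S : {set 'I_n}) c S * p.@[ind R S].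
have Ec (I : {set 'I_n}) : \sum_(S : {set 'I_n}) c S * (I \subset S)%:R = E I.
  rewrite Hc [RHS]big_mkcond; apply: eq_bigr => S _.
  by case: (I \subset S); rewrite ?mulr1 ?mulr0.
(* At a 0/1 point the indicators of [I \subset S] and [J \subset S] multiply to that of
   [I :|: J \subset S]. *)
have LM p q : L (p * q) = \sum_I \sum_J set_coef p I * set_coef q J * E (I :|: J).
  under eq_bigr => I _ do under eq_bigr => J _ do rewrite -Ec mulr_sumr.
  under eq_bigr => I _ do rewrite exchange_big.
  rewrite exchange_big; apply: eq_bigr => S _ /=.
  rewrite mevalM !meval_ind mulr_suml mulr_sumr; apply: eq_bigr => I _.
  rewrite !mulr_sumr; apply: eq_bigr => J _.
  by rewrite subUset -mulnb natrM; ring.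
have Lsum (I : Type) (s : seq I) (F : I -> {mpoly R[n]}) : L (\sum_(i <- s) F i) = \sum_(i <- s) L (F i).
  rewrite /L exchange_big; apply: eq_bigr => S _ /=.
  by rewrite raddf_sum mulr_sumr.
have L1 : L 1 = E set0.
  by rewrite -Ec; apply: eq_bigr => S _; rewrite meval1 sub0set.
have LD p q : L (p + q) = L p + L q.
  by rewrite /L -big_split; apply: eq_bigr => S _; rewrite mevalD mulrDr.
have : L (\sum_(i < size (Clique R G k)) (Clique R G k)`_i * g i) = 0.
  rewrite Lsum big1 // => i _.
  have : (Clique R G k)`_i \in Clique R G k by exact: mem_nth.
  rewrite {1}/Clique !mem_cat => /or3P[/mapP[j _ ->]|/mapP[[a b]]|].
  - rewrite /L big1 // => S _; rewrite mevalM mevalB expr2 mevalM mevalXU /ind.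
    by case: (_ \in S); rewrite ?mulr1 ?mulr0 subrr mul0r mulr0.
  - rewrite mem_enum inE => /andP[/= ab abG] ->.
    have abE J : E ([set a; b] :|: J) = 0.
      apply: (Ecl _ a b) => //; rewrite ?inE ?eqxx ?orbT //.
      by apply: contraTneq ab => ->; rewrite ltnn.
    rewrite (_ : L _ = \sum_J set_coef (g i) J * E ([set a; b] :|: J)); last first.
      under [RHS]eq_bigr => J _ do rewrite -Ec mulr_sumr.
      rewrite [RHS]exchange_big; apply: eq_bigr => S _ /=.
      rewrite !mevalM !mevalXU meval_ind mulrA mulr_sumr.
      apply: eq_bigr => J _; rewrite !subUset !sub1set -!mulnb !natrM /ind; ring.
    by rewrite big1 // => J _; rewrite abE mulr0.
  - rewrite inE => /eqP fi; have := dg i; rewrite fi /mdeg_le => dgi.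
    rewrite (_ : L _ = \sum_J set_coef (g i) J * (\sum_v E (v |: J) - k%:R * E J)); last first.
      transitivity (\sum_J set_coef (g i) J *
          \sum_(S : {set 'I_n}) c S * ((\sum_v ((v |: J) \subset S)%:R) - k%:R * (J \subset S)%:R)).
        under [RHS]eq_bigr => J _ do rewrite mulr_sumr.
        rewrite exchange_big; apply: eq_bigr => S _ /=.
        rewrite mevalM mevalB (raddf_sum (meval _)) mevalMn meval1 meval_ind mulr_sumr mulr_sumr.
        apply: eq_bigr => J _.
        rewrite [X in _ = _ * (_ * (X - _))](eq_bigr (fun v => ind R S v * (J \subset S)%:R)); last first.
          by move=> v _; rewrite subUset sub1set -mulnb natrM.
        rewrite -mulr_suml (eq_bigr (ind R S)) => [|v _]; last exact: mevalXU.
        ring.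
      apply: eq_bigr => J _; congr (_ * _).
      under [X in _ = X - _]eq_bigr => v _ do rewrite -Ec.
      rewrite -Ec exchange_big mulr_sumr -sumrB; apply: eq_bigr => S _ /=.
      by rewrite mulrBr mulr_sumr mulrCA.
    rewrite big1 // => J _.
    (* The linear axiom has degree at least 1, so its cofactor has degree at most [2r - 1] and has
       no coefficient on sets of size [2r] or more, where [Elin] is silent. *)
    have [J2|J2] := ltnP #|J| (2 * r); first by rewrite Elin // subrr mulr0.
    rewrite (@set_coef_eq0 _ _ (2 * r).-1) ?mul0r //; last by move: J2 r0; lia.
    have [->|g_neq0] := eqVneq (g i) 0; first by rewrite msize0.
    have szf : (msize (\sum_(i < n) 'X_i - k%:R : {mpoly R[n]}) >= 2)%N.
      pose v0 := Ordinal n0.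
      have : U_(v0)%MM \in msupp (\sum_(i < n) 'X_i - k%:R : {mpoly R[n]}).
        rewrite mcoeff_msupp mcoeffB (raddf_sum (mcoeff _)) (bigD1 v0) //= big1 => [|j jv].
          rewrite mcoeffXU eqxx mcoeffMn mcoeff1 -mdeg_eq0 mdeg1 /= mul0rn.
          by rewrite subr0 addr0 oner_eq0.
        by rewrite mcoeffXU (negPf jv).
      by move/msize_mdeg_lt; rewrite mdeg1.
    have f_neq0 : \sum_(i < n) 'X_i - k%:R != 0 :> {mpoly R[n]}.
      by apply: contraTneq szf => ->; rewrite msize0.
    move: dgi; rewrite msizeM //; move: szf r0; move: (mmeasure _ _) (mmeasure _ _) => x y; lia.
(* The axiom side evaluates to 0, the other side to at least [E set0 > 0]. *)
rewrite eq_gh LD L1 Lsum; apply/eqP; rewrite gt_eqF //.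
rewrite ltr_wpDr // big_seq sumr_ge0 // => q qh.
rewrite expr2 LM; apply: Epsd => I rI.
by apply: set_coef_eq0 rI; exact: dh.
Qed.
End Mpoly.

(** * Cliques, common neighbours and the pseudo-expectation *)

(** The pair [(I, v)] with [v] in [I] corresponds to [(I :\ v, v)]. This is how a vertex is split
    off a set, both in the derivative of the form and in the homogenization. *)
Lemma sum_setU1 (R : nmodType) (T : finType) (h : {set T} -> T -> R) :
  \sum_(I : {set T}) \sum_(v in I) h I v =
  \sum_(I : {set T}) \sum_(v | v \notin I) h (v |: I) v.
Proof.
rewrite !pair_big_dep /=.
rewrite (reindex_onto (fun p : {set T} * T => (p.2 |: p.1, p.2)) (fun p => (p.1 :\ p.2, p.2))) /=.
  apply: eq_bigl => -[I v] /=; rewrite setU11 /= xpair_eqE eqxx andbT.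
  apply/eqP/idP => [<-|vI]; first by rewrite setD11.
  by rewrite setU1K.
by move=> [I v] /= vI; rewrite setD1K.
Qed.

Section Graph.
Variables (n : nat) (G : {set {set 'I_n}}).

Definition clique (S : {set 'I_n}) : bool :=
  [forall u in S, forall v in S, (u != v) ==> ([set u; v] \in G)].

Definition nbrs (S : {set 'I_n}) : {set 'I_n} :=
  [set v | [forall s in S, (v != s) && ([set v; s] \in G)]].

Lemma cliqueP (S : {set 'I_n}) :
  reflect (forall u v, u \in S -> v \in S -> u != v -> [set u; v] \in G) (clique S).
Proof.
apply: (iffP forall_inP) => [H u v uS vS uv|H u uS].
  by have /forall_inP/(_ v vS)/implyP/(_ uv) := H u uS.
by apply/forall_inP => v vS; apply/implyP; apply: H.
Qed.

Lemma clique_sub (S U : {set 'I_n}) : S \subset U -> clique U -> clique S.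
Proof. by move=> /subsetP sSU /cliqueP H; apply/cliqueP => u v /sSU uU /sSU; apply: H. Qed.

Lemma nbrsP (S : {set 'I_n}) v :
  reflect (forall s, s \in S -> v != s /\ [set v; s] \in G) (v \in nbrs S).
Proof.
rewrite inE; apply: (iffP forall_inP) => H s sS; first by apply/andP/H.
by apply/andP/H.
Qed.

Lemma nbrs_notin (S : {set 'I_n}) v : v \in nbrs S -> v \notin S.
Proof. by move=> /nbrsP H; apply/negP => /H[]; rewrite eqxx. Qed.

Lemma clique_setU1 (S : {set 'I_n}) v :
  v \notin S -> clique (v |: S) = clique S && (v \in nbrs S).
Proof.
move=> vS; apply/cliqueP/andP => [H|[/cliqueP H /nbrsP vN] x y].
  split; first by apply/cliqueP => x y xS yS; apply: H; rewrite inE ?xS ?yS orbT.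
  apply/nbrsP => s sS; have vs : v != s by apply: contraNneq vS => ->.
  by split=> //; apply: H; rewrite // !inE ?eqxx ?sS ?orbT.
rewrite !inE => /predU1P[->|xS] /predU1P[->|yS]; rewrite ?eqxx // => xy.
- by have [] := vN _ yS.
- by rewrite setUC; have [] := vN _ xS.
- exact: H.
Qed.

Lemma nbrs_setU1 (S : {set 'I_n}) s v :
  (v \in nbrs (s |: S)) = [&& v \in nbrs S, v != s & [set v; s] \in G].
Proof.
apply/nbrsP/and3P => [H|[/nbrsP H vs vsG] x].
  have [vs vsG] := H s (setU11 _ _).
  by split=> //; apply/nbrsP => x xS; apply: H; rewrite inE xS orbT.
by rewrite !inE => /predU1P[-> //|]; apply: H.
Qed.

Variable R : rcfType.

Definition chi (u v : 'I_n) : R :=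
  if u == v then 0 else if [set u; v] \in G then 1 else -1.

(** By [card_nbrs_setU1], adding [s] to [S] then halves the number of common neighbours up to an
    error [(x + 1) / 2]. The signed sum is the form to which concentration applies directly. *)
Definition nbr_balanced (d : nat) (x : R) : Prop :=
  forall (S : {set 'I_n}) s, (#|S| < d)%N -> s \notin S ->
    `|\sum_(v in nbrs S) chi v s| <= x.

(** Equivalent, by rescaling [u] and [w], to an operator norm of [chi] at most [2x], but free of
    square roots. *)
Definition chi_form_le (x : R) : Prop :=
  forall u w : 'I_n -> R,
    `|\sum_i \sum_j u i * w j * chi i j| <= x * (\sum_i u i ^+ 2 + \sum_i w i ^+ 2).

Lemma card_nbrs_setU1 (S : {set 'I_n}) s :
  \sum_(v in nbrs S) chi v s =
  2 * #|nbrs (s |: S)|%:R - #|nbrs S|%:R + (s \in nbrs S)%:R.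
Proof.
have cE (A : {set 'I_n}) : #|A|%:R = \sum_v (v \in A)%:R :> R.
  by rewrite -sum1_card natr_sum big_mkcond; apply: eq_bigr => v _; case: (v \in A).
rewrite !cE big_mkcond /= mulr_sumr -sumrB.
have -> : (s \in nbrs S)%:R = \sum_(v : 'I_n) (if v == s then (v \in nbrs S)%:R else 0) :> R.
  by rewrite -big_mkcond big_pred1_eq.
rewrite -big_split; apply: eq_bigr => v _ /=.
rewrite nbrs_setU1 /chi.
by case: (v \in nbrs S); case: (v == s); case: (_ \in G) => //=; ring.
Qed.

(** Errors do not accumulate: each added vertex halves the previous error and contributes at most
    [(x + 1) / 2], which preserves the bound [x + 1]. *)
Lemma card_nbrs (d : nat) (x : R) (S : {set 'I_n}) :
  0 <= x -> nbr_balanced d x -> (#|S| <= d)%N ->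
  `|#|nbrs S|%:R - n%:R / 2 ^+ #|S| | <= x + 1.
Proof.
move=> x0 bal; have [m] := ubnP #|S|; elim: m S => // m IH S Sm Sd.
have [->|[s sS]] := set_0Vmem S.
  have -> : nbrs set0 = setT by apply/setP => v; rewrite in_setT; apply/nbrsP => s; rewrite inE.
  by rewrite cards0 cardsT card_ord expr0 divr1 subrr normr0 addr_ge0.
have cS : #|S| = (#|S :\ s|).+1 by rewrite (cardsD1 s S) sS.
have := IH (S :\ s); rewrite -cS => /(_ Sm (ltnW _)) => IHs.
have := bal (S :\ s) s; rewrite -cS => /(_ Sd).
rewrite !inE eqxx => /(_ isT); rewrite card_nbrs_setU1 setD1K // => bs.
move: (Sd); rewrite [in X in X -> _]cS => /IHs{}IHs.
rewrite [in n%:R / _]cS exprS.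
have -> : n%:R / (2 * 2 ^+ #|S :\ s|) = (n%:R / 2 ^+ #|S :\ s|) / 2 :> R.
  by rewrite invfM mulrA mulrAC.
move: IHs bs; set a := _ / _; set p := (#|nbrs S|)%:R; set q := (#|nbrs (S :\ s)|)%:R.
set b := (_ \in _)%:R.
have : 0 <= b <= 1 by rewrite /b; case: (_ \in _); rewrite ?ler01 ?lexx.
rewrite !ler_norml; lra.
Qed.

End Graph.

Section PseudoExpectation.
Variables (R : rcfType) (n : nat) (G : {set {set 'I_n}}) (k r : nat).
Hypothesis r_le_k : (2 * r <= k)%N.

(* [j] counts the steps up to size [2 * r]; the recursion solves the equation
   [\sum_v E (v |: I) = k * E I] for [E I]. *)
Fixpoint pE_rec (j : nat) (I : {set 'I_n}) : R :=
  if j is j'.+1 then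
    (k%:R - #|I|%:R)^-1 * \sum_(v | v \notin I) pE_rec j' (v |: I)
  else (clique G I)%:R.

Definition pE (I : {set 'I_n}) : R := pE_rec (2 * r - #|I|) I.

Lemma pE_rec_nonclique j (I : {set 'I_n}) : ~~ clique G I -> pE_rec j I = 0.
Proof.
elim: j I => [|j IH] I nI /=; first by rewrite (negPf nI).
rewrite big1 ?mulr0 // => v _; apply: IH; apply: contra nI.
by apply: clique_sub; apply: subsetUr.
Qed.

Lemma pE_linear (K : {set 'I_n}) :
  (#|K| < 2 * r)%N -> \sum_v pE (v |: K) = k%:R * pE K.
Proof.
move=> K2; rewrite (bigID (mem K)) /=.
rewrite (eq_bigr (fun=> pE K)); last by move=> v vK; rewrite (setUidPr _) // sub1set.
rewrite sumr_const.
have kK : k%:R - #|K|%:R != 0 :> R.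
  by rewrite subr_eq0 eqr_nat; move: r_le_k K2; lia.
rewrite (_ : \sum_(v | v \notin K) _ = (k%:R - #|K|%:R) * pE K).
  by rewrite mulrBl -mulr_natl; ring.
rewrite [in RHS]/pE -(subnSK K2) /= mulVKf //; apply: eq_bigr => v vK.
by rewrite /pE cardsU1 vK.
Qed.

(* The value [pE_rec] would take on a clique of size [2 * r - j] if every set of
   [m] vertices had exactly [n / 2 ^ m] common neighbours. *)
Fixpoint size_weight (j : nat) : R :=
  if j is j'.+1 then
    n%:R / 2 ^+ (2 * r - j) / (k%:R - (2 * r - j)%:R) * size_weight j'
  else 1.

Lemma size_weight_ge0 j : 0 <= size_weight j.
Proof.
elim: j => [|j IH] //=; rewrite mulr_ge0 // divr_ge0 ?divr_ge0 ?exprn_ge0 ?ler0n //.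
by rewrite subr_ge0 ler_nat; move: r_le_k; lia.
Qed.

Lemma size_weight_gt0 j : (0 < n)%N -> (j <= 2 * r)%N -> 0 < size_weight j.
Proof.
move=> n0; elim: j => [|j IH] jr /=; rewrite ?ltr01 //.
rewrite mulr_gt0 ?IH ?(ltnW jr) // divr_gt0 ?divr_gt0 ?exprn_gt0 ?ltr0n //.
by rewrite subr_gt0 ltr_nat; move: r_le_k; lia.
Qed.

(** Each step of the recursion adds a relative error [d] from the number of common neighbours. The
    cross term [d * (2 j d)] is at most [d] because [2 j d <= 1], hence a growth by [2 d] per
    step. *)
Lemma pE_estimate (d : R) j (I : {set 'I_n}) :
  (forall S : {set 'I_n}, (#|S| < 2 * r)%N ->
     `|#|nbrs G S|%:R - n%:R / 2 ^+ #|S| | <= d * (n%:R / 2 ^+ #|S|)) ->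
  0 <= d -> 2 * (2 * r)%:R * d <= 1 ->
  (j + #|I| = 2 * r)%N -> clique G I ->
  `|pE_rec j I - size_weight j| <= 2 * j%:R * d * size_weight j.
Proof.
move=> Hd d0 d1; elim: j I => [|j IH] I jI cI.
  by rewrite /= cI subrr normr0 mulr0 mul0r mul0r.
have I2 : (#|I| < 2 * r)%N by lia.
have w0 := size_weight_ge0 j.
have -> : size_weight j.+1 = n%:R / 2 ^+ #|I| / (k%:R - #|I|%:R) * size_weight j.
  by rewrite /= -jI addKn.
(* Only common neighbours of [I] extend it to a clique; the other terms vanish. *)
rewrite /= (bigID (mem (nbrs G I))) /= [X in _ * (_ + X)]big1 ?addr0; last first.
  by move=> v /andP[vI vN]; apply: pE_rec_nonclique; rewrite clique_setU1 // (negPf vN) andbF.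
rewrite (eq_bigl (mem (nbrs G I))); last first.
  by move=> v /=; rewrite andb_idl //; apply: nbrs_notin.
set a : R := k%:R - _; have a0 : 0 < a by rewrite subr_gt0 ltr_nat (leq_trans I2).
set N := n%:R / _; have N0 : 0 <= N by rewrite divr_ge0 ?exprn_ge0 ?ler0n.
set s := \sum_(_ in _) _.
have -> : a^-1 * s - N / a * size_weight j = a^-1 * (s - N * size_weight j) by ring.
have -> : 2 * j.+1%:R * d * (N / a * size_weight j) =
   a^-1 * (2 * j.+1%:R * d * (N * size_weight j)) by ring.
rewrite normrM ger0_norm ?invr_ge0 ?(ltW a0) // ler_wpM2l ?invr_ge0 ?(ltW a0) //.
have es : `|s - #|nbrs G I|%:R * size_weight j| <= #|nbrs G I|%:R * (2 * j%:R * d * size_weight j).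
  rewrite [X in X * size_weight j](_ : _ = \sum_(v in nbrs G I) 1); last by rewrite sumr_const.
  rewrite mulr_suml -sumrB; under eq_bigr => v _ do rewrite mul1r.
  apply: (le_trans (ler_norm_sum _ _ _)).
  rewrite mulr_natl -sumr_const; apply: ler_sum => v vN; apply: IH.
    by rewrite cardsU1 (nbrs_notin vN); lia.
  by rewrite clique_setU1 ?(nbrs_notin vN) // cI.
have eN := Hd I I2; rewrite -/N in eN.
have jd : 2 * j%:R * d <= 1.
  apply: le_trans d1; rewrite ler_wpM2r // ler_wpM2l //.
  by rewrite ler_nat; lia.
have jd0 : 0 <= 2 * j%:R * d by rewrite !mulr_ge0 ?ler0n.
rewrite (_ : 2 * j.+1%:R * d = 2 * j%:R * d + 2 * d) -1?[j.+1%:R]natr1; last by ring.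
rewrite mulrDl.
move: es eN jd jd0; set x := 2 * j%:R * d; set c := #|_|%:R; set w := size_weight j.
move=> es eN jd jd0.
have cN : c <= (1 + d) * N by move: eN; rewrite ler_norml; lra.
have -> : s - N * w = (s - c * w) + (c - N) * w by ring.
apply: (le_trans (ler_normD _ _)); rewrite normrM (ger0_norm w0) -/w.
have h1 : `|c - N| * w <= d * N * w by apply: ler_wpM2r.
have h2 : c * (x * w) <= (1 + d) * N * (x * w) by rewrite ler_wpM2r // mulr_ge0.
have dNw0 : 0 <= d * (N * w) by exact: mulr_ge0 d0 (mulr_ge0 N0 w0).
have h3 : d * (N * w) * x <= d * (N * w) * 1 by exact: ler_wpM2l.
lra.
Qed.

End PseudoExpectation.

(** * Quadratic forms indexed by sets *)

(** Binomial inversion determines [b m] as [a m] minus the sum of ['C(m, j) * b j] over [j < m].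
    With [b j <= a j] kept in the induction, the growth of [a] bounds that sum by [a m / 2], since
    the binomials add up to at most [2 ^ r]. *)
Lemma binomial_expansion_pos (R : realFieldType) (r : nat) (a : nat -> R) :
  (forall i, (i <= r)%N -> 0 <= a i) ->
  (forall i j, (j < i <= r)%N -> 2 * 2 ^+ r * a j <= a i) ->
  exists b : nat -> R, forall i, (i <= r)%N ->
    [/\ a i = \sum_(j < i.+1) 'C(i, j)%:R * b j, 0 <= b i & a i / 2 <= b i].
Proof.
move=> a0 aS.
suff [b Hb] : exists b : nat -> R, forall i, (i < r.+1)%N ->
    [/\ a i = \sum_(j < i.+1) 'C(i, j)%:R * b j, a i / 2 <= b i & b i <= a i].
  exists b => i ir; have [e h1 h2] := Hb i ir; split=> //.
  by apply: le_trans h1; rewrite divr_ge0 ?a0.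
have := leqnn r.+1; move: {1 3}r.+1 => m.
elim: m => [|m IH] mr; first by exists (fun=> 0).
have [b Hb] := IH (ltnW mr).
pose s := \sum_(j < m) 'C(m, j)%:R * b j.
exists (fun i => if i == m then a m - s else b i) => i; rewrite ltnS leq_eqVlt.
have lem (p : nat) (F : nat -> R) : (p <= m)%N ->
    \sum_(j < p) F j * (if val j == m then a m - s else b j) = \sum_(j < p) F j * b j.
  move=> pm; apply: eq_bigr => j _; rewrite ifF //; apply/negP => /eqP jm.
  by have := ltn_ord j; move: pm jm => /=; lia.
case/predU1P => [->|im]; last first.
  have [e1 e2 e3] := Hb i im; rewrite (ltn_eqF im); split=> //.
  by rewrite (lem _ (fun j => 'C(i, j)%:R)).
rewrite eqxx big_ord_recr /= eqxx binn mul1r (lem _ (fun j => 'C(m, j)%:R)) // -/s.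
rewrite addrC subrK; split=> //; last first.
  rewrite gerBl sumr_ge0 // => j _; rewrite mulr_ge0 //.
  by have [_ + _] := Hb j (ltn_ord j); apply: le_trans; rewrite divr_ge0 // a0 //; have := ltn_ord j; lia.
have : 2 ^+ r * (2 * s) <= 2 ^+ r * a m.
  rewrite /s !mulr_sumr.
  apply: (@le_trans _ _ (\sum_(j < m) 'C(m, j)%:R * a m)).
    apply: ler_sum => j _; have [_ _ h] := Hb j (ltn_ord j).
    have -> : 2 ^+ r * (2 * ('C(m, j)%:R * b j)) = 'C(m, j)%:R * (2 * 2 ^+ r * b j) by ring.
    rewrite ler_wpM2l //; apply: (@le_trans _ _ (2 * 2 ^+ r * a j)).
      by rewrite ler_wpM2l // mulr_ge0 // exprn_ge0.
    by apply: aS; rewrite ltn_ord.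
  rewrite -mulr_suml ler_wpM2r ?a0 // -natrX -natr_sum ler_nat.
  apply: (@leq_trans (2 ^ m)); last by rewrite leq_exp2l.
  rewrite -[2%N]/(1 + 1)%N expnDn [leqRHS]big_ord_recr /= (leq_trans _ (leq_addr _ _)) //.
  by apply: leq_sum => j _; rewrite !exp1n !muln1.
rewrite ler_pM2l ?exprn_gt0 //; lra.
Qed.

Lemma sum_subset_card (R : comNzRingType) (T : finType) (B : {set T}) (b : nat -> R) :
  \sum_(A : {set T} | A \subset B) b #|A| = \sum_(j < #|B|.+1) 'C(#|B|, j)%:R * b j.
Proof.
rewrite (partition_big (fun A : {set T} => inord #|A| : 'I_#|B|.+1) predT) //=.
apply: eq_bigr => j _; rewrite -(cards_draws B j) mulr_natl -sumr_const.
apply: eq_big => [A|A /andP[sAB]].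
  rewrite inE; apply: andb_id2l => /subset_leq_card sAB.
  by rewrite -val_eqE /= inordK.
by move=> /eqP <-; rewrite inordK // ltnS subset_leq_card.
Qed.

(* Expanding [a] in binomials turns the form into a sum of squares. *)
Lemma johnson_form_ge (R : realFieldType) (T : finType) (r : nat) (a : nat -> R)
    (g : {set T} -> R) :
  (forall i, (i <= r)%N -> 0 <= a i) ->
  (forall i j, (j < i <= r)%N -> 2 * 2 ^+ r * a j <= a i) ->
  (forall I : {set T}, #|I| != r -> g I = 0) ->
  a r / 2 * \sum_I g I ^+ 2 <= \sum_I \sum_J a #|I :&: J| * (g I * g J).
Proof.
move=> a0 aS gr; have [b Hb] := binomial_expansion_pos a0 aS.
have -> : \sum_I \sum_J a #|I :&: J| * (g I * g J) =
    \sum_(A : {set T}) b #|A| * (\sum_(I : {set T} | A \subset I) g I) ^+ 2.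
  transitivity (\sum_(I : {set T}) \sum_(J : {set T}) \sum_(A : {set T}) b #|A| * (g I * (A \subset I)%:R) * (g J * (A \subset J)%:R)).
    apply: eq_bigr => I _; apply: eq_bigr => J _.
    have [Ir|nIr] := eqVneq #|I| r; last by rewrite gr // big1 => [|A _]; rewrite ?mul0r ?mulr0 ?mul0r.
    have IJr : (#|I :&: J| <= r)%N by rewrite -Ir subset_leq_card // subsetIl.
    have [-> _ _] := Hb _ IJr; rewrite -sum_subset_card mulr_suml big_mkcond.
    apply: eq_bigr => A _; rewrite subsetI.
    by case: (A \subset I); case: (A \subset J); rewrite /= ?mulr0 ?mul0r ?mulr1 ?mulr0 ?mulrA.
  under eq_bigr => I _ do rewrite exchange_big.
  rewrite exchange_big; apply: eq_bigr => A _ /=.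
  have -> : \sum_(I : {set T} | A \subset I) g I = \sum_(I : {set T}) g I * (A \subset I)%:R.
    by rewrite big_mkcond; apply: eq_bigr => I _; case: ifP; rewrite ?mulr1 ?mulr0.
  rewrite expr2 mulr_suml mulr_sumr; apply: eq_bigr => I _.
  by rewrite [RHS]mulrA mulr_sumr; apply: eq_bigr => J _.
(* The sets [A] of size [r] already give the bound: there the inner sum is [g A] and
   [b r >= a r / 2]. Smaller sets only add squares, and larger ones contribute 0. *)
rewrite mulr_sumr; apply: ler_sum => A _.
have sumA (I : {set T}) : A \subset I -> (r <= #|A|)%N -> I != A -> g I = 0.
  move=> sAI rA neIA; apply: gr; apply: contraNneq neIA => Ir.
  by rewrite eq_sym eqEcard sAI Ir.
have [Ar|rA|Ar] := ltngtP #|A| r.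
- rewrite gr ?expr0n ?mulr0 ?(ltn_eqF Ar) //.
  by have [_ b0 _] := Hb _ (ltnW Ar); rewrite mulr_ge0 // sqr_ge0.
- rewrite gr ?(gtn_eqF rA) // expr0n mulr0 big1 ?expr0n ?mulr0 // => I sAI.
  have [->|] := eqVneq I A; first by rewrite gr // gtn_eqF.
  by apply: sumA => //; exact: ltnW.
have [_ _ br] := Hb _ (leqnn r).
rewrite (bigD1 A) //= big1 ?addr0 ?Ar ?ler_wpM2r ?sqr_ge0 // => I /andP[sAI].
by apply: sumA => //; rewrite Ar.
Qed.

Lemma card_draws_le (T : finType) (m : nat) : (#|[set A : {set T} | #|A| == m]| <= #|T| ^ m)%N.
Proof.
rewrite card_draws; apply: leq_trans (leq_pmulr _ (fact_gt0 m)) _.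
rewrite bin_ffact; elim: m => [|m IH]; first by rewrite ffactn0.
by rewrite ffactnSr expnSr leq_mul // leq_subr.
Qed.

(** Group the sets [J] by [A = I :&: J]: there are [2 ^ p] choices of [A], and at most
    [#|T| ^ (p - #|A|)] sets [J] for each, because [J :\: A] determines [J]. *)
Lemma row_sum_le (R : realFieldType) (T : finType) (p : nat) (f : nat -> R) (Y : R)
    (I : {set T}) :
  (forall i, (i <= p)%N -> 0 <= f i) ->
  (forall i, (i <= p)%N -> f i * #|T|%:R ^+ (p - i) <= Y) -> #|I| = p ->
  \sum_(J : {set T} | #|J| == p) f #|I :&: J| <= 2 ^+ p * Y.
Proof.
move=> f0 fY Ip.
rewrite (partition_big (fun J : {set T} => I :&: J) (fun A => A \subset I)) /=; last first.
  by move=> J _; apply: subsetIl.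
apply: (@le_trans _ _ (\sum_(A : {set T} | A \subset I) Y)); last first.
  rewrite sumr_const -natrX mulr_natl.
  have -> : #|[pred A : {set T} | A \subset I]| = #|powerset I|.
    by apply: eq_card => A; rewrite !inE.
  by rewrite card_powerset Ip.
apply: ler_sum => A sAI; have Ap : (#|A| <= p)%N by rewrite -Ip subset_leq_card.
rewrite (eq_bigr (fun=> f #|A|)) => [|J /andP[_ /eqP-> //]].
rewrite sumr_const -mulr_natr; apply: le_trans (fY _ Ap).
rewrite ler_wpM2l ?f0 // -natrX ler_nat.
apply: leq_trans (card_draws_le T (p - #|A|)).
pose S := [set J : {set T} | (#|J| == p) && (I :&: J == A)].
rewrite (_ : #|_| = #|S|); last by apply: eq_card => J; rewrite [in RHS]inE.
have injS : {in S &, injective (fun J => J :\: A)}.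
  move=> J K; rewrite !inE => /andP[_ /eqP JA] /andP[_ /eqP KA] /(congr1 (setU A)).
  have sJ : A \subset J by rewrite -JA subsetIr.
  have sK : A \subset K by rewrite -KA subsetIr.
  by rewrite !setDE !setUIr !setUCr !setIT (setUidPr sJ) (setUidPr sK).
rewrite -(card_in_imset injS); apply: subset_leq_card; apply/subsetP => K.
move=> /imsetP[J]; rewrite !inE => /andP[/eqP Jp /eqP JA] ->.
by rewrite cardsD Jp (_ : J :&: A = A) //; apply/setIidPr; rewrite -JA subsetIr.
Qed.

Lemma deriv_prod (R : comNzRingType) (T : finType) (P : pred T) (F : T -> {poly R}) :
  (\prod_(x | P x) F x)^`() = \sum_(x | P x) (F x)^`() * \prod_(y | P y && (y != x)) F y.
Proof.
have [m] := ubnP #|P|; elim: m P => // m IH P Pm.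
have [x Px|P0] := pickP P; last by rewrite !big_pred0 // derivE.
rewrite (bigD1 x) //= derivM [RHS](bigD1 x) //=; congr (_ + _).
rewrite IH; last first.
  by rewrite ltnS in Pm; apply: leq_trans Pm; rewrite (cardD1 x P) [x \in P]Px add1n ltnS;
     apply: subset_leq_card; apply/subsetP => y; rewrite !inE andbC.
rewrite mulr_sumr; apply: eq_bigr => y /andP[Py yx].
rewrite [in RHS](bigD1 x) /=; last by rewrite Px eq_sym.
rewrite mulrCA; congr (_ * (_ * _)); apply: eq_bigl => z.
by rewrite -!andbA; congr (_ && _); rewrite andbC.
Qed.

(** * Interpolating between the random and the expected form *)

Section CrossEdges.
Variables (R : rcfType) (n : nat) (G : {set {set 'I_n}}).
Implicit Types (I J : {set 'I_n}) (u v : 'I_n).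
Local Notation ch := (chi G R).

Definition soft_edge (t : R) u v : R := (1 + t * ch u v) / 2.

Definition soft_cross (t : R) I J : R :=
  \prod_(u in I :\: J) \prod_(v in J :\: I) soft_edge t u v.

Lemma soft_edge01 t u v : 0 <= t <= 1 -> 0 <= soft_edge t u v <= 1.
Proof. by move=> t01; rewrite /soft_edge /chi; do 2?[case: ifP => _]; lra. Qed.

Lemma prod_itv01 (K : finType) (P : pred K) (F : K -> R) :
  (forall x, 0 <= F x <= 1) -> 0 <= \prod_(x | P x) F x <= 1.
Proof.
move=> F01; elim/big_rec: _ => [|x y _ /andP[y0 y1]]; first by rewrite ler01 lexx.
by have /andP[F0 F1] := F01 x; rewrite mulr_ge0 //= mulr_ile1.
Qed.

(** [soft_edge] as a polynomial in [t], so that derivatives are formal and the mean value theorem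
    for polynomials applies. *)
Definition soft_edge_poly u v : {poly R} := (2^-1)%:P * (1 + (ch u v)%:P * 'X).

Definition soft_cross_poly I J : {poly R} :=
  \prod_(u in I :\: J) \prod_(v in J :\: I) soft_edge_poly u v.

Lemma soft_edge_polyE u v t : (soft_edge_poly u v).[t] = soft_edge t u v.
Proof. by rewrite /soft_edge_poly !hornerE /soft_edge mulrC (mulrC t). Qed.

Lemma soft_cross_polyE I J t : (soft_cross_poly I J).[t] = soft_cross t I J.
Proof.
rewrite /soft_cross_poly horner_prod; apply: eq_bigr => u _.
by rewrite horner_prod; apply: eq_bigr => v _; rewrite soft_edge_polyE.
Qed.

Lemma deriv_soft_cross I J t :
  (soft_cross_poly I J)^`().[t] =
  \sum_(u in I :\: J) \sum_(v in J :\: I) ch u v / 2 *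
    \prod_(v' | (v' \in J :\: I) && (v' != v)) soft_edge t u v' *
    \prod_(u' | (u' \in I :\: J) && (u' != u)) \prod_(v' in J :\: I) soft_edge t u' v'.
Proof.
rewrite /soft_cross_poly deriv_prod horner_sum; apply: eq_bigr => u _.
rewrite deriv_prod mulr_suml horner_sum; apply: eq_bigr => v _.
rewrite !hornerM !horner_prod.
congr (_ * _ * _).
- by rewrite /soft_edge_poly !derivE !hornerE /=; ring.
- by apply: eq_bigr => v' _; rewrite soft_edge_polyE.
- apply: eq_bigr => u' _; rewrite horner_prod.
  by apply: eq_bigr => v' _; rewrite soft_edge_polyE.
Qed.

Lemma soft_cross0 I J : soft_cross 0 I J = 2^-1 ^+ (#|I :\: J| * #|J :\: I|).
Proof.
rewrite /soft_cross (eq_bigr (fun=> 2^-1 ^+ #|J :\: I|)); last first.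
  move=> u _; rewrite -prodr_const; apply: eq_bigr => v _.
  by rewrite /soft_edge mul0r addr0 mul1r.
by rewrite prodr_const -exprM mulnC.
Qed.

(** At [t = 1] each factor is an edge indicator. Pairs inside [I] or inside [J] are edges already,
    so only the cross pairs decide whether the union is a clique. *)
Lemma soft_cross1 I J : clique G I -> clique G J ->
  soft_cross 1 I J = (clique G (I :|: J))%:R.
Proof.
move=> /cliqueP cI /cliqueP cJ.
have se u v : u != v -> soft_edge 1 u v = ([set u; v] \in G)%:R.
  by move=> uv; rewrite /soft_edge /chi (negPf uv); case: (_ \in G) => /=; lra.
have neIJ u v : u \in I :\: J -> v \in J :\: I -> u != v.
  by rewrite !inE => /andP[uJ _] /andP[_ vJ]; apply: contraNneq uJ => ->.
have [/exists_inP[u uIJ /exists_inP[v vJI uvG]]|noG] :=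
    boolP [exists u in I :\: J, exists v in J :\: I, [set u; v] \notin G].
  rewrite (_ : clique G _ = false).
    rewrite /soft_cross (bigD1 u) //= (bigD1 v) //= se ?neIJ // (negPf uvG).
    by rewrite !mul0r.
  apply: contraNF uvG => /cliqueP; apply; last exact: neIJ.
    by case/setDP: uIJ => uI _; rewrite inE uI.
  by case/setDP: vJI => vJ _; rewrite inE vJ orbT.
have cross u v : u \in I :\: J -> v \in J :\: I -> [set u; v] \in G.
  move=> uIJ vJI; apply: contraNT noG => uvG.
  by apply/exists_inP; exists u => //; apply/exists_inP; exists v.
rewrite (_ : clique G _ = true).
  by rewrite /soft_cross big1 // => u uIJ; rewrite big1 // => v vJI; rewrite se ?neIJ // cross.
apply/cliqueP => u v; rewrite !inE.
case: (boolP (u \in I)) (boolP (v \in I)) => uI [] vI /=; first by move=> _ _; apply: cI.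
- case: (boolP (u \in J)) => uJ _ vJ; first exact: cJ.
  by move=> _; apply: cross; rewrite !inE ?uI ?uJ ?vI.
- case: (boolP (v \in J)) => vJ uJ _; first exact: cJ.
  by move=> _; rewrite setUC; apply: cross; rewrite !inE ?uI ?uJ ?vI ?vJ.
- exact: cJ.
Qed.

(* Differentiating in the edge bias [t] pulls out a single cross edge [uv]; the
   remaining factors split into a function of [u] and a function of [v]. *)
Lemma deriv_soft_form_le (r : nat) (x Y t : R) (f : nat -> R) (g : {set 'I_n} -> R) :
  0 <= t <= 1 -> 0 <= x -> chi_form_le G x ->
  (forall i, 0 <= f i) ->
  (forall i, (i <= r)%N -> f i * n%:R ^+ (r - i) <= Y) ->
  (forall I, #|I| != r.+1 -> g I = 0) ->
  `|\sum_I \sum_J f #|I :&: J| * (g I * g J) * (soft_cross_poly I J)^`().[t]|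
    <= x * r.+1%:R * (2 ^+ r * Y) * \sum_I g I ^+ 2.
Proof.
move=> t01 x0 chix f0 fY gr.
pose X I := \sum_(u | u \notin I) g (u |: I) ^+ 2.
(* Here [u] and [v] have been removed from [I] and [J], which now have size [r] wherever the term is
   nonzero. For fixed [I], [J] the inner double sum is the bilinear form of [chi] at two explicit
   vectors. *)
have -> : \sum_I \sum_J f #|I :&: J| * (g I * g J) * (soft_cross_poly I J)^`().[t] =
  \sum_I \sum_J f #|I :&: J| / 2 *
    (\prod_(u' in I :\: J) \prod_(v' in J :\: I) soft_edge t u' v') *
    \sum_u \sum_v
      ((u \notin I :|: J)%:R * g (u |: I) * \prod_(v' in J :\: I) soft_edge t u v') *
      ((v \notin I :|: J)%:R * g (v |: J) * \prod_(u' in I :\: J) soft_edge t u' v) *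
      ch u v.
  pose h I u J v : R := (u \notin J)%:R * (v \notin I)%:R * (f #|I :&: J| * (g I * g J) *
    (ch u v / 2 *
    \prod_(v' | (v' \in J :\: I) && (v' != v)) soft_edge t u v' *
    \prod_(u' | (u' \in I :\: J) && (u' != u)) \prod_(v' in J :\: I) soft_edge t u' v')).
  transitivity (\sum_(I : {set 'I_n}) \sum_(u in I) \sum_(J : {set 'I_n}) \sum_(v in J) h I u J v).
    apply: eq_bigr => I _; rewrite exchange_big; apply: eq_bigr => J _ /=.
    rewrite deriv_soft_cross mulr_sumr big_mkcond [RHS]big_mkcond; apply: eq_bigr => u _ /=.
    rewrite inE; case: (boolP (u \in I)) => uI; rewrite ?andbF // andbT.
    rewrite mulr_sumr [LHS](_ : _ = if u \notin J then \sum_(v in J :\: I) f #|I :&: J| * (g I * g J) *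
    (ch u v / 2 *
    \prod_(v' | (v' \in J :\: I) && (v' != v)) soft_edge t u v' *
    \prod_(u' | (u' \in I :\: J) && (u' != u)) \prod_(v' in J :\: I) soft_edge t u' v') else 0) //.
    rewrite /h; case: (boolP (u \in J)) => uJ /=; last first.
      rewrite big_mkcond [RHS]big_mkcond; apply: eq_bigr => v _ /=; rewrite !inE.
      by case: (v \in I); case: (v \in J); rewrite /= ?mul1r ?mul0r.
    by rewrite big1 // => v _; rewrite !mul0r.
  rewrite sum_setU1; apply: eq_bigr => I _ /=.
  transitivity (\sum_(u | u \notin I) \sum_(J : {set 'I_n}) \sum_(v | v \notin J) h (u |: I) u (v |: J) v).
    by apply: eq_bigr => u _; rewrite sum_setU1.
  rewrite exchange_big; apply: eq_bigr => J _ /=.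
  rewrite mulr_sumr big_mkcond; apply: eq_bigr => u _.
  case: (boolP (u \in I)) => uI /=.
    by rewrite [X in _ = _ * X]big1 ?mulr0 // => v _; rewrite inE uI /= !mul0r.
  rewrite mulr_sumr big_mkcond; apply: eq_bigr => v _.
  case: (boolP (v \in J)) => vJ /=.
    by rewrite !inE vJ orbT /= !(mul0r, mulr0).
  rewrite /h !inE !negb_or.
  (* The zero diagonal of [chi] removes the case where the two split-off vertices coincide. *)
  have [->|uv] := eqVneq u v; first by rewrite /chi eqxx !(mul0r, mulr0).
  case: (boolP (u \in J)) => uJ; first by rewrite /= ?andbF !(mul0r, mulr0).
  case: (boolP (v \in I)) => vI; first by rewrite /= ?andbF !(mul0r, mulr0).
  rewrite ?uI ?vJ /=.
  have -> : (u |: I) :&: (v |: J) = I :&: J.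
    apply/setP => w; rewrite !inE.
    have [->|wu] := eqVneq w u; first by rewrite (negPf uv) (negPf uJ) (negPf uI).
    by have [->|] := eqVneq w v; rewrite //= (negPf vI).
  have eI w : (w \in (u |: I) :\: (v |: J)) && (w != u) = (w \in I :\: J).
    rewrite !inE; have [->|wu] := eqVneq w u; first by rewrite (negPf uI) !andbF.
    by have [->|] := eqVneq w v; rewrite /= ?andbT // (negPf vI) andbF.
  have eJ w : (w \in (v |: J) :\: (u |: I)) && (w != v) = (w \in J :\: I).
    rewrite !inE; have [->|wv] := eqVneq w v; first by rewrite (negPf vJ) !andbF.
    by have [->|] := eqVneq w u; rewrite /= ?andbT // (negPf uJ) andbF.
  rewrite (eq_bigl _ _ eJ) (eq_bigl _ _ eI).
  have -> : \prod_(u' in I :\: J) \prod_(v' in (v |: J) :\: (u |: I)) soft_edge t u' v' =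
    \prod_(u' in I :\: J) soft_edge t u' v *
    \prod_(u' in I :\: J) \prod_(v' in J :\: I) soft_edge t u' v'.
    rewrite -big_split; apply: eq_bigr => w _ /=.
    rewrite (bigD1 v) /=; last by rewrite !inE eqxx eq_sym (negPf uv) (negPf vI).
    by rewrite (eq_bigl _ _ eJ).
  ring.
(* The remaining soft factors lie in [0, 1], so the two vectors have squared norms at most [X I] and
   [X J]. *)
pose Z := fun I J => if (#|I| == r) && (#|J| == r) then f #|I :&: J| / 2 * (x * (X I + X J)) else 0.
have ZX I J : `|f #|I :&: J| / 2 *
    (\prod_(u' in I :\: J) \prod_(v' in J :\: I) soft_edge t u' v') *
    \sum_u \sum_v
      ((u \notin I :|: J)%:R * g (u |: I) * \prod_(v' in J :\: I) soft_edge t u v') *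
      ((v \notin I :|: J)%:R * g (v |: J) * \prod_(u' in I :\: J) soft_edge t u' v) *
      ch u v| <= Z I J.
  rewrite /Z; case: ifPn => [/andP[/eqP Ir /eqP Jr]|nr]; last first.
    rewrite [X in _ * X]big1 ?mulr0 ?normr0 // => u _; rewrite big1 // => v _.
    case: (boolP (u \in I :|: J)) => [_|]; first by rewrite !mul0r.
    case: (boolP (v \in I :|: J)) => [_|]; first by rewrite !(mul0r, mulr0).
    rewrite !inE !negb_or => /andP[vI vJ] /andP[uI uJ].
    move: nr; rewrite negb_and => /orP[Ir|Jr].
      by rewrite (gr (u |: I)) ?cardsU1 ?uI ?add1n ?eqSS // !(mul0r, mulr0).
    by rewrite (gr (v |: J)) ?cardsU1 ?vJ ?add1n ?eqSS // !(mul0r, mulr0).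
  rewrite -mulrA normrM ger0_norm ?divr_ge0 ?f0 // ler_wpM2l ?divr_ge0 ?f0 //.
  rewrite normrM -[leRHS]mul1r ler_pM //.
    have /andP[p0 p1] : 0 <= \prod_(u' in I :\: J) \prod_(v' in J :\: I) soft_edge t u' v' <= 1.
      by apply: prod_itv01 => u'; apply: prod_itv01 => v'; apply: soft_edge01.
    by rewrite ger0_norm.
  apply: (le_trans (chix _ _)); rewrite ler_wpM2l //.
  have sqX (K : {set 'I_n}) u (P : pred 'I_n) (F : 'I_n -> R) (b : bool) : (b -> u \notin K) ->
      (forall w, 0 <= F w <= 1) ->
      (b%:R * g (u |: K) * \prod_(w | P w) F w) ^+ 2 <= if u \notin K then g (u |: K) ^+ 2 else 0.
    case: b => [/(_ isT) ->|_] F01; last by rewrite !mul0r expr0n; case: ifP; rewrite ?sqr_ge0.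
    have /andP[p0 p1] := prod_itv01 P F01.
    by rewrite mul1r exprMn ler_piMr ?sqr_ge0 // exprn_ile1.
  have XE K : X K = \sum_u if u \notin K then g (u |: K) ^+ 2 else 0 by rewrite /X big_mkcond.
  rewrite !XE.
  apply: lerD; apply: ler_sum => u _; apply: sqX.
  - by rewrite !inE negb_or => /andP[].
  - by move=> w; apply: soft_edge01.
  - by rewrite !inE negb_or => /andP[].
  - by move=> w; apply: soft_edge01.
apply: (le_trans (ler_norm_sum _ _ _)).
apply: (@le_trans _ _ (\sum_I \sum_J Z I J)).
  apply: ler_sum => I _; apply: (le_trans (ler_norm_sum _ _ _)).
  by apply: ler_sum => J _; apply: ZX.
have X0 I : 0 <= X I by apply: sumr_ge0 => u _; apply: sqr_ge0.
pose W I J := if (#|I| == r) && (#|J| == r) then f #|I :&: J| * X I else 0.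
(* The summand is symmetric in [I] and [J], so half of [X I + X J] may be replaced by [X I]. *)
have -> : \sum_I \sum_J Z I J = x * \sum_I \sum_J W I J.
  rewrite -[LHS](_ : x * (\sum_I \sum_J W I J + \sum_I \sum_J W I J) / 2 = _).
    by field.
  rewrite {2}exchange_big -big_split mulr_sumr mulr_suml; apply: eq_bigr => I _ /=.
  rewrite -big_split mulr_sumr mulr_suml; apply: eq_bigr => J _ /=.
  rewrite /W /Z (andbC (#|J| == r)) (setIC J I).
  by case: ifP => _; rewrite ?(addr0, mulr0, mul0r) //; field.
rewrite -!mulrA ler_wpM2l //.
apply: (@le_trans _ _ (\sum_I X I * (2 ^+ r * Y))).
  apply: ler_sum => I _; rewrite /W; have [Ir|nIr] := eqVneq #|I| r; last first.
    rewrite big1 // (_ : X I = 0) ?mul0r // /X big1 // => u uI.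
    by rewrite gr ?expr0n // cardsU1 uI add1n eqSS.
  rewrite /= -big_mkcond /= -mulr_suml mulrC ler_wpM2l //.
  by apply: row_sum_le => // i ir; rewrite card_ord; apply: fY.
rewrite -mulr_suml.
(* Each set of size [r + 1] arises as [u |: I] in [r + 1] ways. *)
have -> : \sum_I X I = r.+1%:R * \sum_I g I ^+ 2.
  rewrite /X -(sum_setU1 (fun I _ => g I ^+ 2)) mulr_sumr; apply: eq_bigr => I _.
  rewrite sumr_const mulr_natl; have [-> //|nIr] := eqVneq #|I| r.+1.
  by rewrite gr // expr0n /= !mul0rn.
by rewrite le_eqVlt; apply/orP; left; apply/eqP; ring.
Qed.

End CrossEdges.

(** The mean value theorem in [t] equates the difference with the derivative at some point of (0,
    1). *)
Lemma soft_form_diff_le (R : rcfType) (n : nat) (G : {set {set 'I_n}}) (r : nat) (x Y : R)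
    (f : nat -> R) (g : {set 'I_n} -> R) :
  0 <= x -> chi_form_le G x ->
  (forall i, 0 <= f i) ->
  (forall i, (i <= r)%N -> f i * n%:R ^+ (r - i) <= Y) ->
  (forall I : {set 'I_n}, #|I| != r.+1 -> g I = 0) ->
  `|\sum_I \sum_J f #|I :&: J| * (g I * g J) * soft_cross G 1 I J -
    \sum_I \sum_J f #|I :&: J| * (g I * g J) * soft_cross G 0 I J|
    <= x * r.+1%:R * (2 ^+ r * Y) * \sum_I g I ^+ 2.
Proof.
move=> x0 chix f0 fY gr.
pose q : {poly R} := \sum_I \sum_J (f #|I :&: J| * (g I * g J)) *: soft_cross_poly R G I J.
have qE t : q.[t] = \sum_I \sum_J f #|I :&: J| * (g I * g J) * soft_cross G t I J.
  rewrite horner_sum; apply: eq_bigr => I _; rewrite horner_sum; apply: eq_bigr => J _.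
  by rewrite hornerZ soft_cross_polyE.
have [c] := poly_mvt q (@ltr01 R).
rewrite in_itv /= => /andP[c0 c1]; rewrite subr0 mulr1 !qE => ->.
have -> : q^`().[c] = \sum_I \sum_J f #|I :&: J| * (g I * g J) * (soft_cross_poly R G I J)^`().[c].
  rewrite raddf_sum horner_sum; apply: eq_bigr => I _.
  rewrite raddf_sum horner_sum; apply: eq_bigr => J _.
  by rewrite /= derivZ hornerZ.
by apply: deriv_soft_form_le => //; rewrite (ltW c0) (ltW c1).
Qed.

(** Schur test: [2 |g I| |g J| <= g I ^ 2 + g J ^ 2] and symmetry reduce the form to the row sums of
    [row_sum_le]. *)
Lemma weighted_form_le (R : realFieldType) (T : finType) (r : nat) (Y : R)
    (f : nat -> R) (g : {set T} -> R) :
  (forall i, 0 <= f i) ->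
  (forall i, (i <= r)%N -> f i * #|T|%:R ^+ (r - i) <= Y) ->
  (forall I : {set T}, #|I| != r -> g I = 0) ->
  \sum_I \sum_J f #|I :&: J| * (`|g I| * `|g J|) <= 2 ^+ r * Y * \sum_I g I ^+ 2.
Proof.
move=> f0 fY gr.
pose W (I J : {set T}) := if (#|I| == r) && (#|J| == r) then f #|I :&: J| * g I ^+ 2 else 0.
apply: (@le_trans _ _ (\sum_I \sum_J W I J)).
  rewrite -[leRHS](_ : (\sum_I \sum_J W I J + \sum_I \sum_J W I J) / 2 = _); last by field.
  rewrite [X in _ <= (_ + X) / 2]exchange_big -big_split mulr_suml; apply: ler_sum => I _ /=.
  rewrite -big_split mulr_suml; apply: ler_sum => J _ /=.
  rewrite /W (andbC (#|J| == r)) (setIC J I).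
  have [Ir|nIr] := eqVneq #|I| r; last by rewrite (gr I) // normr0 /= !(mul0r, mulr0, addr0).
  have [Jr|nJr] := eqVneq #|J| r; last by rewrite (gr J) // normr0 /= !(mul0r, mulr0, addr0).
  rewrite -[g I ^+ 2]real_normK ?num_real // -[g J ^+ 2]real_normK ?num_real //=.
  have -> : (f #|I :&: J| * `|g I| ^+ 2 + f #|I :&: J| * `|g J| ^+ 2) / 2 =
     f #|I :&: J| * ((`|g I| ^+ 2 + `|g J| ^+ 2) / 2) by field.
  rewrite ler_wpM2l //; have := sqr_ge0 (`|g I| - `|g J|); rewrite sqrrB; lra.
rewrite mulr_sumr; apply: ler_sum => I _; rewrite /W.
have [Ir|nIr] := eqVneq #|I| r; last by rewrite big1 // mulr_ge0 ?sqr_ge0 // mulr_ge0 ?exprn_ge0 // (le_trans _ (fY r _)) // mulr_ge0 ?exprn_ge0.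
rewrite /= -big_mkcond /= -mulr_suml ler_wpM2r ?sqr_ge0 //.
by apply: row_sum_le.
Qed.

(** Absorbs all factors depending on [r] alone into one constant to the power [r ^ 2], the shape in
    which the constant of the theorem appears after taking [r]-th powers. *)
Lemma constant_growth (r : nat) : (0 < r)%N ->
  (6 * r * 2 ^ r * 4 ^ r * 4 ^ (r ^ 2) <= 1024 ^ (r ^ 2))%N.
Proof.
move=> r0.
have h : (6 * r <= 8 ^ r)%N by elim: r r0 => // -[|r] IH _ //; rewrite expnS; have := IH isT; lia.
apply: (@leq_trans (8 ^ r * 2 ^ r * 4 ^ r * 4 ^ (r ^ 2))); first by rewrite !leq_mul2r h !orbT.
rewrite -!expnMn; apply: (@leq_trans (64 ^ (r ^ 2) * 4 ^ (r ^ 2))).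
  by rewrite leq_mul2r leq_exp2l // -mulnn leq_pmulr ?orbT.
by rewrite -expnMn leq_exp2r // expn_gt0 r0.
Qed.

(** * Positivity of the pseudo-expectation on homogeneous forms *)

Section PSD.
Variables (R : rcfType) (n : nat) (G : {set {set 'I_n}}) (k r : nat) (x : R).
Hypotheses (r_gt0 : (0 < r)%N) (r_le_k : (2 * r <= k)%N) (x_ge1 : 1 <= x)
  (bal : nbr_balanced G (2 * r) x) (chix : chi_form_le G x)
  (x_small : x * k%:R ^+ r * 1024 ^+ (r ^ 2) <= n%:R).

Local Notation w := (size_weight R n k r).
Local Notation kappa := ((k%:R * 4 ^+ r) ^+ r : R).

Let k_gt0 : (0 < k)%N. Proof. by move: r_gt0 r_le_k; lia. Qed.

Let x_ge0 : 0 <= x. Proof. exact: le_trans x_ge1. Qed.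

Lemma x_kappa_le : 6 * r%:R * 2 ^+ r * 4 ^+ r * kappa * x <= n%:R.
Proof.
apply: le_trans x_small; rewrite exprMn -exprM mulnn.
have -> : 6 * r%:R * 2 ^+ r * 4 ^+ r * (k%:R ^+ r * 4 ^+ (r ^ 2)) * x =
   x * k%:R ^+ r * (6 * r%:R * 2 ^+ r * 4 ^+ r * 4 ^+ (r ^ 2)) by ring.
rewrite ler_wpM2l ?mulr_ge0 ?exprn_ge0 //.
by rewrite -!natrX -!natrM ler_nat constant_growth.
Qed.

Let pow_ge1 (m p : nat) : (0 < m)%N -> 1 <= m%:R ^+ p :> R.
Proof. by move=> m0; rewrite exprn_ege1 // ler1n. Qed.

Lemma kappa_ge : k%:R * 4 ^+ r <= kappa.
Proof.
rewrite -[leLHS]expr1 ler_weXn2l // mulr_ege1 ?ler1n //.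
exact: (pow_ge1 r (isT : (0 < 4)%N)).
Qed.

Let n_gt0 : (0 < n)%N.
Proof.
rewrite -(ltr0n R); apply: lt_le_trans x_small.
by rewrite !mulr_gt0 ?exprn_gt0 ?ltr0n // (lt_le_trans ltr01).
Qed.

(** The ratio of consecutive weights is [n / (2 ^ m * (k - m))] with [m < 2 r], where
    [2 ^ m <= 4 ^ r] and [k - m <= k]. *)
Lemma size_weight_step j : (j < 2 * r)%N -> w j * n%:R <= k%:R * 4 ^+ r * w j.+1.
Proof.
move=> jr /=; have w0 := size_weight_ge0 R n r_le_k j.
set m := (2 * r - j.+1)%N; have mr : (m < 2 * r)%N by rewrite /m; lia.
have a0 : 0 < k%:R - m%:R :> R by rewrite subr_gt0 ltr_nat; move: r_le_k mr; lia.
have -> : k%:R * 4 ^+ r * (n%:R / 2 ^+ m / (k%:R - m%:R) * w j) =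
  w j * n%:R * (4 ^+ r / 2 ^+ m * (k%:R / (k%:R - m%:R))).
  by field; rewrite ?expf_neq0 ?pnatr_eq0 ?gt_eqF.
rewrite ler_peMr ?mulr_ge0 // mulr_ege1 //.
  rewrite ler_pdivlMr ?exprn_gt0 // mul1r.
  have -> : 4 = 2 ^+ 2 :> R by ring.
  by rewrite -exprM ler_weXn2l ?ler1n // ltnW.
by rewrite ler_pdivlMr // mul1r gerBl.
Qed.

Lemma size_weight_le i p : (i + p <= 2 * r)%N ->
  w i * n%:R ^+ p <= (k%:R * 4 ^+ r) ^+ p * w (i + p)%N.
Proof.
elim: p => [|p IH] ip; first by rewrite addn0 mulr1 mul1r.
rewrite exprSr mulrA addnS; apply: (@le_trans _ _ ((k%:R * 4 ^+ r) ^+ p * w (i + p)%N * n%:R)).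
  by rewrite ler_wpM2r // IH // ltnW // -addnS.
rewrite exprSr -!mulrA ler_wpM2l ?exprn_ge0 ?mulr_ge0 ?exprn_ge0 // mulrA.
by apply: size_weight_step; rewrite -addnS.
Qed.

(** The row sum hypothesis with [Y = kappa * w r]: the [n ^ (r - i)] sets that may meet a given one
    in [i] points are offset by the decay of [w i]. *)
Lemma size_weight_le_kappa i : (i <= r)%N -> w i * n%:R ^+ (r - i) <= kappa * w r.
Proof.
move=> ir; have := @size_weight_le i (r - i); rewrite subnKC // => /(_ _)/le_trans; apply.
  by move: ir; lia.
rewrite ler_wpM2r ?size_weight_ge0 // ler_weXn2l ?leq_subr //.
by rewrite mulr_ege1 ?ler1n //; apply: (pow_ge1 r (isT : (0 < 4)%N)).
Qed.

(** Relative error of the common neighbour counts: the absolute error is at most [x + 1 <= 2 x], and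
    [2 * 2 ^ #|S| <= 4 ^ r] when [#|S| < 2 r]. *)
Let d := 4 ^+ r * x / n%:R.

Lemma nbrs_estimate (S : {set 'I_n}) : (#|S| < 2 * r)%N ->
  `|#|nbrs G S|%:R - n%:R / 2 ^+ #|S| | <= d * (n%:R / 2 ^+ #|S|).
Proof.
move=> Sr; apply: (le_trans (card_nbrs x_ge0 bal (ltnW Sr))).
apply: (@le_trans _ _ (2 * x)); first by move: x_ge1; lra.
have -> : d * (n%:R / 2 ^+ #|S|) = 4 ^+ r / 2 ^+ #|S| * x.
  by rewrite /d; field; rewrite expf_neq0 ?pnatr_eq0 -?lt0n.
rewrite ler_wpM2r // ler_pdivlMr ?exprn_gt0 // -exprS.
have -> : 4 = 2 ^+ 2 :> R by ring.
by rewrite -exprM ler_weXn2l ?ler1n.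
Qed.

(** The total relative error over [2 r] recursion steps; staying below 1 keeps the value at the
    empty set positive. *)
Lemma nbrs_error_small : 2 * (2 * r)%:R * d <= 2 / 3.
Proof.
rewrite /d mulrA ler_pdivrMr ?ltr0n // natrM.
have := x_kappa_le.
have -> : 2 * (2 * r%:R) * (4 ^+ r * x) = (r%:R * 4 ^+ r * x) * 4 by ring.
have -> : 6 * r%:R * 2 ^+ r * 4 ^+ r * kappa * x =
    (r%:R * 4 ^+ r * x) * (2 ^+ r * kappa) * 6 by ring.
have : r%:R * 4 ^+ r * x <= r%:R * 4 ^+ r * x * (2 ^+ r * kappa).
  rewrite ler_peMr ?mulr_ge0 ?exprn_ge0 // mulr_ege1 //.
    exact: (pow_ge1 r (isT : (0 < 2)%N)).
  apply: le_trans kappa_ge; rewrite mulr_ege1 ?ler1n //.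
  exact: (pow_ge1 r (isT : (0 < 4)%N)).
lra.
Qed.

Lemma nbrs_error_ge0 : 0 <= d.
Proof. by rewrite divr_ge0 ?mulr_ge0 ?exprn_ge0. Qed.

Lemma pE_set0_gt0 : 0 < pE R G k r set0.
Proof.
have wr0 : 0 < w (2 * r) by apply: size_weight_gt0.
have d1 := nbrs_error_small.
have := @pE_estimate R n G k r r_le_k d (2 * r) set0 nbrs_estimate nbrs_error_ge0.
rewrite cards0 addn0 /pE cards0 subn0 => /(_ _ erefl) H.
have {}H : `|pE_rec R G k (2 * r) set0 - w (2 * r)| <= 2 * (2 * r)%:R * d * w (2 * r).
  by apply: H; [move: d1; lra | apply/cliqueP => u v; rewrite inE].
have : 2 * (2 * r)%:R * d * w (2 * r) <= 2 / 3 * w (2 * r) by rewrite ler_wpM2r // ltW.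
move: H; rewrite ler_norml; lra.
Qed.

(** Since [#|I :|: J| = 2 r - #|I :&: J|], the recursion at the union has depth [#|I :&: J|]. If the
    union is not a clique, both compared quantities vanish. *)
Lemma pE_union_estimate (I J : {set 'I_n}) :
  #|I| = r -> #|J| = r -> clique G I -> clique G J ->
  `|pE R G k r (I :|: J) - w #|I :&: J| * soft_cross G 1 I J|
    <= 2 * r%:R * d * w #|I :&: J|.
Proof.
move=> Ir Jr cI cJ; rewrite soft_cross1 //.
have d0 := nbrs_error_ge0.
have cIJ : (#|I :|: J| + #|I :&: J|)%N = (2 * r)%N by rewrite cardsUI Ir Jr mul2n addnn.
have IJr : (#|I :&: J| <= r)%N by rewrite -Ir subset_leq_card ?subsetIl.
have ww := size_weight_ge0 R n r_le_k #|I :&: J|.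
have n0 : 0 < n%:R :> R by rewrite ltr0n.
case: (boolP (clique G _)) => cU; last first.
  by rewrite /pE pE_rec_nonclique // mulr0 subr0 normr0 ?mulr_ge0 ?exprn_ge0 ?invr_ge0.
rewrite mulr1 /pE (_ : (2 * r - #|I :|: J|)%N = #|I :&: J|); last by rewrite -cIJ addKn.
apply: le_trans (_ : 2 * #|I :&: J|%:R * d * w #|I :&: J| <= _); last first.
  by rewrite ler_wpM2r // ler_wpM2r // ler_wpM2l // ler_nat.
apply: (pE_estimate r_le_k nbrs_estimate nbrs_error_ge0 _ _ cU); last by rewrite addnC.
by have := nbrs_error_small; lra.
Qed.

Lemma pE_form_ge0 (g : {set 'I_n} -> R) :
  (forall I : {set 'I_n}, #|I| != r -> g I = 0) ->
  0 <= \sum_I \sum_J g I * g J * pE R G k r (I :|: J).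
Proof.
(* [pE] vanishes on nonclique unions, so [g] may be restricted to cliques, as [soft_cross1]
   requires. *)
move=> gr; pose g' I := if clique G I then g I else 0.
have g'r (I : {set 'I_n}) : #|I| != r -> g' I = 0 by move=> /gr gI; rewrite /g' gI; case: ifP.
have -> : \sum_I \sum_J g I * g J * pE R G k r (I :|: J) =
    \sum_I \sum_J g' I * g' J * pE R G k r (I :|: J).
  apply: eq_bigr => I _; apply: eq_bigr => J _; rewrite /g' /pE.
  case: (boolP (clique G (I :|: J))) => cU; last by rewrite pE_rec_nonclique // !mulr0.
  by rewrite (clique_sub (subsetUl _ _) cU) (clique_sub (subsetUr _ _) cU).
set s := \sum_I g' I ^+ 2; have s0 : 0 <= s by apply: sumr_ge0 => I _; apply: sqr_ge0.
have n0 : 0 < n%:R :> R by rewrite ltr0n.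
have w0 i : 0 <= w i by apply: size_weight_ge0.
have wr0 : 0 < w r by apply: size_weight_gt0 => //; lia.
have err1 : `|\sum_I \sum_J g' I * g' J * pE R G k r (I :|: J) -
    \sum_I \sum_J w #|I :&: J| * (g' I * g' J) * soft_cross G 1 I J| <=
    2 * r%:R * d * (2 ^+ r * (kappa * w r) * s).
  have := @weighted_form_le R 'I_n r (kappa * w r) w g' w0.
  rewrite card_ord => /(_ size_weight_le_kappa g'r) H.
  apply: (@le_trans _ _ (2 * r%:R * d * \sum_I \sum_J w #|I :&: J| * (`|g' I| * `|g' J|))); last first.
    by rewrite ler_wpM2l // !mulr_ge0 ?exprn_ge0 ?invr_ge0.
  rewrite -sumrB mulr_sumr; apply: (le_trans (ler_norm_sum _ _ _)); apply: ler_sum => I _.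
  rewrite -sumrB mulr_sumr; apply: (le_trans (ler_norm_sum _ _ _)); apply: ler_sum => J _.
  have -> : g' I * g' J * pE R G k r (I :|: J) - w #|I :&: J| * (g' I * g' J) * soft_cross G 1 I J =
    (g' I * g' J) * (pE R G k r (I :|: J) - w #|I :&: J| * soft_cross G 1 I J) by ring.
  rewrite !normrM.
  have -> : 2 * r%:R * d * (w #|I :&: J| * (`|g' I| * `|g' J|)) =
    (`|g' I| * `|g' J|) * (2 * r%:R * d * w #|I :&: J|) by ring.
  have [Ir|/g'r->] := eqVneq #|I| r; last by rewrite normr0 !mul0r.
  have [Jr|/g'r->] := eqVneq #|J| r; last by rewrite normr0 !(mul0r, mulr0).
  rewrite {1 3}/g'; case: ifP => cI; last by rewrite normr0 !mul0r.
  rewrite {1 2}/g'; case: ifP => cJ; last by rewrite normr0 !(mul0r, mulr0).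
  by rewrite ler_wpM2l ?mulr_ge0 // pE_union_estimate.
have err2 : `|\sum_I \sum_J w #|I :&: J| * (g' I * g' J) * soft_cross G 1 I J -
    \sum_I \sum_J w #|I :&: J| * (g' I * g' J) * soft_cross G 0 I J| <=
    x * r%:R * (2 ^+ r * (kappa * w r / n%:R)) * s.
  (* The derivative splits one vertex off sets of size [r], hence [r.-1]. The power of [n] saved
     this way is the factor [1 / n] that beats [x]. *)
  have := @soft_form_diff_le R n G r.-1 x (kappa * w r / n%:R) w g' x_ge0 chix w0.
  rewrite (prednK r_gt0) => /(_ _ g'r)/le_trans; apply.
    move=> i ir; rewrite ler_pdivlMr // -mulrA -exprSr -subSn // prednK //.
    by apply: size_weight_le_kappa; move: ir r_gt0; lia.
  rewrite ler_wpM2r // ler_wpM2l ?mulr_ge0 //.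
  rewrite ler_wpM2r ?mulr_ge0 ?invr_ge0 ?exprn_ge0 ?mulr_ge0 ?exprn_ge0 //.
  by rewrite ler_weXn2l ?ler1n // leq_pred.
(* There are [(r - i) ^ 2] cross pairs between two [r]-sets meeting in [i] points, each with mean
   1/2. *)
pose a i := w i * 2^-1 ^+ ((r - i) ^ 2).
have main : w r / 2 * s <= \sum_I \sum_J w #|I :&: J| * (g' I * g' J) * soft_cross G 0 I J.
  have -> : \sum_I \sum_J w #|I :&: J| * (g' I * g' J) * soft_cross G 0 I J =
     \sum_I \sum_J a #|I :&: J| * (g' I * g' J).
    apply: eq_bigr => I _; apply: eq_bigr => J _.
    have [Ir|/g'r->] := eqVneq #|I| r; last by rewrite !(mul0r, mulr0).
    have [Jr|/g'r->] := eqVneq #|J| r; last by rewrite !(mul0r, mulr0).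
    rewrite soft_cross0 /a cardsD cardsD (setIC J I) Ir Jr mulnn; ring.
  have -> : w r = a r by rewrite /a subnn expr0 mulr1.
  apply: johnson_form_ge => //.
    by move=> i _; rewrite /a mulr_ge0 // exprn_ge0 ?invr_ge0.
  have step i : (i < r)%N -> 2 * 2 ^+ r * a i <= a i.+1.
    move=> ir; rewrite /a mulrA; apply: ler_pM.
    - by rewrite !mulr_ge0 ?exprn_ge0.
    - by rewrite exprn_ge0 ?invr_ge0.
    - rewrite -(ler_pM2r n0) -[leLHS]mulrA.
      apply: (@le_trans _ _ (2 * 2 ^+ r * (k%:R * 4 ^+ r * w i.+1))).
        by rewrite ler_wpM2l ?mulr_ge0 ?exprn_ge0 // size_weight_step //; lia.
      rewrite [leRHS]mulrC mulrA ler_wpM2r //; apply: le_trans x_kappa_le.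
      have h1 := kappa_ge.
      have -> : 6 * r%:R * 2 ^+ r * 4 ^+ r * kappa * x = (2 ^+ r * kappa) * (6 * (r%:R * 4 ^+ r * x)) by ring.
      have -> : 2 * 2 ^+ r * (k%:R * 4 ^+ r) = (2 ^+ r * (k%:R * 4 ^+ r)) * 2 :> R by ring.
      apply: ler_pM => //; rewrite ?mulr_ge0 ?exprn_ge0 ?ler_wpM2l ?exprn_ge0 //.
      have : 1 <= r%:R * 4 ^+ r * x.
        rewrite mulr_ege1 // mulr_ege1 ?ler1n //.
        exact: (pow_ge1 r (isT : (0 < 4)%N)).
      lra.
    - rewrite ler_wiXn2l ?invr_ge0 ?invf_le1 ?ler1n //.
      by rewrite leq_sqr leq_sub2l.
  move=> i j /andP[]; elim: i => // i IH; rewrite ltnS leq_eqVlt => /predU1P[->|ji] ir.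
    exact: step.
  apply: le_trans (step _ ir); have IHi := IH ji (ltnW ir).
  have ai0 : 0 <= a i by rewrite /a mulr_ge0 ?exprn_ge0 ?invr_ge0.
  apply: le_trans IHi _; rewrite ler_peMl // mulr_ege1 ?ler1n //.
  exact: (pow_ge1 r (isT : (0 < 2)%N)).
(* The two errors add up to at most [3 r 2^r 4^r kappa x / n] times [w r * s]; the constant 6 in
   [x_kappa_le] makes this factor at most 1/2. *)
have tot : 2 * r%:R * d * (2 ^+ r * (kappa * w r) * s) +
    x * r%:R * (2 ^+ r * (kappa * w r / n%:R)) * s <= w r / 2 * s.
  have -> : 2 * r%:R * d * (2 ^+ r * (kappa * w r) * s) +
    x * r%:R * (2 ^+ r * (kappa * w r / n%:R)) * s =
    (w r * s) * ((2 * r%:R * 2 ^+ r * 4 ^+ r * kappa * x + r%:R * 2 ^+ r * 1 * kappa * x) / n%:R).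
    by rewrite /d; field; rewrite gt_eqF.
  have -> : w r / 2 * s = (w r * s) * (1 / 2) by field.
  rewrite ler_wpM2l ?mulr_ge0 // ler_pdivrMr //.
  have h : r%:R * 2 ^+ r * 1 * kappa * x <= r%:R * 2 ^+ r * 4 ^+ r * kappa * x.
    rewrite ler_wpM2r // ler_wpM2r ?exprn_ge0 ?mulr_ge0 ?exprn_ge0 //.
    by rewrite ler_wpM2l ?mulr_ge0 ?exprn_ge0 //; apply: (pow_ge1 r (isT : (0 < 4)%N)).
  have := x_kappa_le; lra.
move: err1 err2; rewrite !ler_norml; lra.
Qed.

End PSD.

(** * Homogenization and the deterministic theorem *)

Section Homogenize.
Variables (R : realFieldType) (n k r : nat) (E : {set 'I_n} -> R).
Hypotheses (r_lt_k : (r <= k)%N)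
  (E_linear : forall K : {set 'I_n}, (#|K| < 2 * r)%N -> \sum_v E (v |: K) = k%:R * E K).

(** Modulo the linear axiom and [x_v ^ 2 = x_v], a monomial [x_I] equals the sum of [x_(v |: I)]
    over [v] outside [I], divided by [k - #|I|]. Applying this to the lowest degree repeatedly
    raises all monomials to degree [r]. *)
Lemma homogenize (F : {set 'I_n} -> R) :
  (forall I : {set 'I_n}, (r < #|I|)%N -> F I = 0) ->
  exists2 F' : {set 'I_n} -> R, (forall I : {set 'I_n}, #|I| != r -> F' I = 0) &
    forall J : {set 'I_n}, (#|J| <= r)%N ->
      \sum_I F I * E (I :|: J) = \sum_I F' I * E (I :|: J).
Proof.
move=> Fr.
suff H d : (d <= r)%N -> exists2 F' : {set 'I_n} -> R,
    (forall I : {set 'I_n}, ~~ (d <= #|I| <= r)%N -> F' I = 0) &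
    forall J : {set 'I_n}, (#|J| <= r)%N ->
      \sum_I F I * E (I :|: J) = \sum_I F' I * E (I :|: J).
  have [F' F'r F'E] := H r (leqnn r); exists F' => // I.
  by rewrite eqn_leq andbC => /F'r.
elim: d => [|d IH] dr; first by exists F => // I /=; rewrite -ltnNge; apply: Fr.
have [F' F'r F'E] := IH (ltnW dr).
pose low (I : {set 'I_n}) := if #|I| == d then F' I / (k%:R - d%:R) else 0.
exists (fun I : {set 'I_n} => (if #|I| == d then 0 else F' I) + \sum_(v in I) low (I :\ v)).
  move=> I; rewrite negb_and => Id.
  rewrite [X in _ + X]big1 ?addr0 => [|v vI].
    case: eqP => // /eqP nd; apply: F'r; move: Id nd; lia.
  rewrite /low ifF //; apply/negP => /eqP; move: Id; rewrite (cardsD1 v I) vI; lia.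
move=> J Jr; rewrite F'E //.
under [RHS]eq_bigr => I _ do rewrite mulrDl mulr_suml.
rewrite big_split /= sum_setU1 -big_split; apply: eq_bigr => I _ /=.
rewrite (eq_bigr (fun v => low I * E (v |: (I :|: J)))); last first.
  by move=> v vI; rewrite setU1K // setUA.
rewrite -mulr_sumr /low; case: eqP => [Id|_]; last by rewrite mul0r addr0.
have kd : k%:R - d%:R != 0 :> R by rewrite subr_eq0 eqr_nat; move: r_lt_k dr; lia.
rewrite mul0r add0r -mulrA; congr (_ * _); apply: (canRL (mulKf kd)).
(* The degree being raised is [d < r] and [#|J| <= r], so the linear identity is available at the
   union. *)
have K2 : (#|I :|: J| < 2 * r)%N.
  by rewrite (leq_ltn_trans (leq_card_setU I J)) // Id mul2n -addnn -addSn leq_add.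
have := E_linear K2; rewrite (bigID (mem I)) /= (eq_bigr (fun=> E (I :|: J))); last first.
  by move=> v vI; rewrite setUA (setUidPr (_ : [set v] \subset I)) ?sub1set.
by rewrite sumr_const Id mulrBl => <-; rewrite mulr_natl addrAC subrr add0r.
Qed.

(** The replacement is made in one argument at a time, the other argument being supported on sets of
    size at most [r] throughout. *)
Lemma form_ge0_homogenize :
  (forall g : {set 'I_n} -> R, (forall I : {set 'I_n}, #|I| != r -> g I = 0) ->
     0 <= \sum_I \sum_J g I * g J * E (I :|: J)) ->
  forall F : {set 'I_n} -> R, (forall I : {set 'I_n}, (r < #|I|)%N -> F I = 0) ->
     0 <= \sum_I \sum_J F I * F J * E (I :|: J).
Proof.
move=> psd F Fr; have [F' F'r F'E] := homogenize Fr; have := psd F' F'r; congr (_ <= _).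
transitivity (\sum_I F' I * \sum_J F' J * E (J :|: I)).
  apply: eq_bigr => I _; rewrite mulr_sumr; apply: eq_bigr => J _.
  by rewrite setUC mulrA.
transitivity (\sum_I F' I * \sum_J F J * E (J :|: I)).
  apply: eq_bigr => I _; have [Ir|/F'r->] := eqVneq #|I| r; last by rewrite !mul0r.
  by rewrite F'E // Ir.
transitivity (\sum_J F J * \sum_I F' I * E (I :|: J)).
  under eq_bigr => I _ do rewrite mulr_sumr.
  rewrite exchange_big; apply: eq_bigr => J _; rewrite mulr_sumr; apply: eq_bigr => I _.
  by rewrite setUC mulrCA.
transitivity (\sum_J F J * \sum_I F I * E (I :|: J)).
  apply: eq_bigr => J _; have [Jr|/Fr->] := leqP #|J| r; last by rewrite !mul0r.
  by rewrite F'E.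
apply: eq_bigr => J _; rewrite mulr_sumr; apply: eq_bigr => I _.
by rewrite setUC mulrA.
Qed.

End Homogenize.

(** The indicator vector of [S] solves the system, so evaluation at it is a genuine expectation. *)
Lemma clique_no_refutation (R : realType) (n r : nat) (G : {set {set 'I_n}}) (S : {set 'I_n}) :
  (0 < r)%N -> (0 < n)%N -> clique G S -> ~ PS_refutation r (Clique R G #|S|).
Proof.
move=> r0 n0 /cliqueP cS; apply: (@Mpoly.no_refutation R n r #|S| G (fun I => (I \subset S)%:R)) => //.
- by rewrite sub0set ltr01.
- move=> I i j iI jI ij ijG; case: (boolP (I \subset S)) => // /subsetP sIS.
  by rewrite cS ?sIS in ijG.
- move=> K _; rewrite -sum1_card natr_sum mulr_suml [RHS]big_mkcond; apply: eq_bigr => v _ /=.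
  by rewrite subUset sub1set mul1r; case: (v \in S).
- move=> F _; set s := \sum_(I : {set 'I_n}) F I * (I \subset S)%:R.
  rewrite (_ : \sum_I _ = s ^+ 2) ?sqr_ge0 // expr2 mulr_suml; apply: eq_bigr => I _.
  rewrite mulr_sumr; apply: eq_bigr => J _.
  by rewrite subUset -mulnb natrM; ring.
Qed.

(* Covers [k < 2 * r], where the recursion defining [pE] divides by zero. *)
Lemma exists_clique (R : rcfType) (n : nat) (G : {set {set 'I_n}}) (d : nat) (x : R) :
  1 <= x -> nbr_balanced G d x -> 2 * x * 2 ^+ d < n%:R ->
  forall m, (m <= d)%N -> exists2 S : {set 'I_n}, #|S| = m & clique G S.
Proof.
move=> x1 bal xn; elim=> [|m IH] md.
  by exists set0; rewrite ?cards0 //; apply/cliqueP => u v; rewrite inE.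
have [S Sm cS] := IH (ltnW md).
have [N0|[v vN]] := set_0Vmem (nbrs G S); last first.
  exists (v |: S); first by rewrite cardsU1 (nbrs_notin vN) Sm.
  by rewrite clique_setU1 ?(nbrs_notin vN) // cS.
have Sd : (#|S| <= d)%N by rewrite Sm ltnW.
have x0 : 0 <= x by apply: le_trans x1.
have := card_nbrs x0 bal Sd; rewrite N0 cards0 sub0r normrN.
rewrite ger0_norm ?divr_ge0 ?exprn_ge0 // ler_pdivrMr ?exprn_gt0 // => nx.
have : (x + 1) * 2 ^+ #|S| <= 2 * x * 2 ^+ d.
  rewrite ler_pM ?exprn_ge0 //; first by lra.
    by lra.
  by rewrite ler_weXn2l ?ler1n.
lra.
Qed.

Theorem balanced_no_refutation (R : realType) (n : nat) (G : {set {set 'I_n}}) (k r : nat) (x : R) :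
  (0 < r)%N -> (0 < n)%N -> 1 <= x ->
  nbr_balanced G (2 * r) x -> chi_form_le G x ->
  x * k%:R ^+ r * 1024 ^+ (r ^ 2) <= n%:R ->
  ~ PS_refutation r (Clique R G k).
Proof.
move=> r0 n0 x1 bal chix xn.
have [k2|k2] := leqP (2 * r) k.
  apply: (@Mpoly.no_refutation R n r k G (pE R G k r)) => //.
  - exact: (pE_set0_gt0 r0 k2 x1 bal xn).
  - move=> I i j iI jI ij ijG; apply: pE_rec_nonclique.
    by apply: contra ijG => /cliqueP; apply.
  - by move=> K; apply: pE_linear.
  - apply: (@form_ge0_homogenize R n k r).
    + exact: leq_trans (leq_pmull r (isT : (0 < 2)%N)) k2.
    + by move=> K; apply: pE_linear.
    + exact: (pE_form_ge0 r0 k2 x1 bal chix xn).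
(* For [k = 0] the hypothesis on [x] says nothing about [n], so the empty clique is used
   directly. *)
have [->|k0] := posnP k.
  rewrite -(cards0 'I_n); apply: clique_no_refutation => //.
  by apply/cliqueP => u v; rewrite inE.
have [|S <- cS] := @exists_clique R n G (2 * r) x x1 bal _ k (ltnW k2); last first.
  exact: clique_no_refutation.
apply: lt_le_trans xn.
have k1 : 1 <= k%:R ^+ r :> R by rewrite exprn_ege1 // ler1n.
have c1 : 2 * 2 ^+ (2 * r) < 1024 ^+ (r ^ 2) :> R.
  rewrite -exprS -!natrX ltr_nat (_ : 1024 = 2 ^ 10)%N // -expnM ltn_exp2l //.
  rewrite -mulnn; nia.
apply: (@lt_le_trans _ _ (x * 1024 ^+ (r ^ 2))).
  rewrite (_ : 2 * x * _ = x * (2 * 2 ^+ (2 * r))); last by ring.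
  by rewrite ltr_pM2l // (lt_le_trans ltr01).
rewrite ler_wpM2r ?exprn_ge0 // ler_peMr // (le_trans _ x1) //.
Qed.

From mathcomp Require Import classical_sets topology normedtype sequences exp.
(* [classical_sets] reuses most lemma names of [finset]. *)
Import mathcomp.boot.fintype mathcomp.boot.finset.
Import numFieldNormedType.Exports.
(** * Concentration for the random graph *)

(** Obtained from [1 + y <= expR y] alone, at the price of the constant 2. If [x ^ 2 > 1/4] then
    [|x| <= 2 x ^ 2]; otherwise [expR y <= 1 / (1 - y)] at [x] and [-x] averages to
    [1 / (1 - x ^ 2)]. *)
Lemma cosh_le_expR (R : realType) (x : R) : (expR x + expR (- x)) / 2 <= expR (2 * x ^+ 2).
Proof.
have [x2|x2] := leP (x ^+ 2) (1 / 4); last first.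
  have h : `|x| <= 2 * x ^+ 2.
    rewrite -(real_normK (num_real x)) in x2 *; have := normr_ge0 x; nra.
  have e1 : expR x <= expR (2 * x ^+ 2) by rewrite ler_expR; apply: le_trans h; apply: ler_norm.
  have e2 : expR (- x) <= expR (2 * x ^+ 2).
    by rewrite ler_expR; apply: le_trans h; rewrite -normrN ler_norm.
  lra.
have x1 : -1 < x < 1 by apply/andP; split; nra.
have bnd (y : R) : -1 < y < 1 -> expR y <= (1 - y)^-1.
  move=> y1; rewrite -[expR y]invrK -expRN lef_pV2 ?posrE ?expR_gt0 //; last by lra.
  exact: expR_ge1Dx.
have b1 := bnd x x1; have b2 : expR (- x) <= (1 + x)^-1.
  by rewrite -[x in (1 + x)^-1]opprK; apply: bnd; lra.
apply: (@le_trans _ _ (1 + 2 * x ^+ 2)); last exact: expR_ge1Dx.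
apply: (@le_trans _ _ (((1 - x)^-1 + (1 + x)^-1) / 2)); first by lra.
have -> : ((1 - x)^-1 + (1 + x)^-1) / 2 = (1 - x ^+ 2)^-1.
  by field; apply/and3P; split; apply: lt0r_neq0; nra.
rewrite -[leLHS]mul1r ler_pdivrMr; nra.
Qed.

Section RandomGraph.
Variables (R : realType) (n : nat).
Implicit Types (G : {set {set 'I_n}}) (F : {set {set 'I_n}} -> R).

Definition Gavg F : R := \sum_(G in powerset (vpairs n)) F G / 2 ^+ #|vpairs n|.

Lemma Gnp_prob_half (A : {set {set 'I_n}} -> Prop) :
  Gnp_prob (1 / 2 : R) A = Gavg (fun G => (`[< A G >])%:R).
Proof.
rewrite /Gnp_prob /Gavg big_mkcondr; apply: eq_bigr => G _.
case: asboolP => _; last by rewrite mul0r.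
rewrite (eq_bigr (fun=> 2^-1)) => [|e _]; first by rewrite prodr_const mul1r exprVn.
by case: ifP => _; field.
Qed.

Lemma Gavg_le F F' : (forall G, F G <= F' G) -> Gavg F <= Gavg F'.
Proof. by move=> FF; apply: ler_sum => G _; rewrite ler_wpM2r ?invr_ge0 ?exprn_ge0. Qed.

Lemma GavgD F F' : Gavg (fun G => F G + F' G) = Gavg F + Gavg F'.
Proof. by rewrite /Gavg -big_split; apply: eq_bigr => G _; rewrite mulrDl. Qed.

Lemma GavgZ a F : Gavg (fun G => a * F G) = a * Gavg F.
Proof. by rewrite /Gavg mulr_sumr; apply: eq_bigr => G _; rewrite mulrA. Qed.

Lemma Gavg_sum (J : Type) (s : seq J) (P : pred J) (F : J -> {set {set 'I_n}} -> R) :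
  Gavg (fun G => \sum_(j <- s | P j) F j G) = \sum_(j <- s | P j) Gavg (F j).
Proof.
by rewrite /Gavg exchange_big; apply: eq_bigr => G _; rewrite mulr_suml.
Qed.

Lemma Gavg_cst a : Gavg (fun=> a) = a.
Proof.
rewrite /Gavg sumr_const card_powerset -[LHS]mulr_natr -mulrA natrX mulVf ?mulr1 //.
by rewrite expf_neq0 ?pnatr_eq0.
Qed.

(** Toggling a pair is an involution preserving the uniform measure; this stands in for the
    independence of the edges. *)
Definition flip (e : {set 'I_n}) G := if e \in G then G :\ e else e |: G.

Lemma flipK e : involutive (flip e).
Proof.
move=> G; rewrite /flip; case: (boolP (e \in G)) => eG; first by rewrite setD11 setD1K.
by rewrite setU11 setU1K.
Qed.

Lemma in_flip e e' G : e' != e -> (e' \in flip e G) = (e' \in G).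
Proof. by move=> ee; rewrite /flip; case: ifP => _; rewrite !inE (negPf ee). Qed.

Lemma in_flip_self e G : (e \in flip e G) = (e \notin G).
Proof. by rewrite /flip; case: ifP => _; rewrite ?setD11 ?setU11. Qed.

Lemma Gavg_flip e F : e \in vpairs n -> Gavg (F \o flip e) = Gavg F.
Proof.
move=> ev; rewrite /Gavg [RHS](reindex_inj (inv_inj (flipK e))); apply: eq_bigl => G.
rewrite !powersetE /flip; case: ifP => eG; last by rewrite subUset sub1set ev.
rewrite subDset; apply/idP/idP => [GV|]; first by rewrite (subset_trans GV) ?subsetUr.
by move/subset_trans; apply; rewrite subUset sub1set ev /=.
Qed.

Definition esign (e : {set 'I_n}) G : R := if e \in G then 1 else -1.

(* The coefficients may depend on the graph, but not on the edges summed over: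
   those edges are averaged out one at a time. *)
Lemma mgf_le (J : eqType) (s : seq J) (ed : J -> {set 'I_n})
    (c : J -> {set {set 'I_n}} -> R) (b : J -> R) :
  uniq (map ed s) -> {in s, forall j, ed j \in vpairs n} ->
  {in s &, forall i j G, c i (flip (ed j) G) = c i G} ->
  {in s, forall j G, c j G ^+ 2 <= b j} ->
  Gavg (fun G => expR (\sum_(j <- s) c j G * esign (ed j) G)) <= expR (2 * \sum_(j <- s) b j).
Proof.
elim: s => [|j s IH] us vs cs bs.
  by rewrite big_nil mulr0 expR0 /Gavg; under eq_bigr => G _ do rewrite big_nil expR0;
    rewrite -[leLHS]/(Gavg (fun=> 1)) Gavg_cst.
move: us => /= /andP[js us].
have sub i : i \in s -> i \in j :: s by rewrite inE orbC => ->.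
have {}IH := IH us (fun i si => vs i (sub i si))
  (fun i k si sk => cs i k (sub i si) (sub k sk)) (fun i si => bs i (sub i si)).
have jj : j \in j :: s by rewrite mem_head.
set F := fun G => _.
(* The flip reverses the sign at [ed j] and leaves the coefficients and the other signs alone, so
   averaging over it produces a hyperbolic cosine. *)
have -> : Gavg F = Gavg (fun G => 2^-1 * (F G + F (flip (ed j) G))).
  by rewrite GavgZ GavgD (Gavg_flip F (vs j jj)); field.
rewrite big_cons mulrDr expRD.
apply: (@le_trans _ _ (expR (2 * b j) * Gavg (fun G => expR (\sum_(j <- s) c j G * esign (ed j) G)))).
  rewrite -GavgZ; apply: Gavg_le => G.
  have -> : F (flip (ed j) G) =
      expR (- (c j G * esign (ed j) G)) * expR (\sum_(i <- s) c i G * esign (ed i) G).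
    rewrite /F big_cons -expRD; congr (expR (_ + _)).
      rewrite cs // -mulrN /esign in_flip_self; case: (ed j \in G) => //=; rewrite ?opprK //.
    apply: eq_big_seq => i si; rewrite cs ?inE ?si ?orbT //; congr (_ * _).
    rewrite /esign in_flip //; apply: contraNneq js => <-; exact: map_f.
  rewrite /F big_cons expRD -mulrDl mulrA ler_wpM2r ?expR_ge0 // mulrC.
  apply: le_trans (cosh_le_expR _) _; rewrite ler_expR ler_wpM2l // exprMn.
  rewrite (_ : esign _ _ ^+ 2 = 1) ?mulr1 ?bs //.
  by rewrite /esign; case: ifP => _; rewrite ?sqrrN expr1n.
by rewrite ler_wpM2l ?expR_ge0.
Qed.

(** Chernoff bound for both signs. The choice [t = l / (4 V)] minimizes [- t l + 2 t ^ 2 V], with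
    value [- l ^ 2 / (8 V)]. *)
Lemma tail_le (J : eqType) (s : seq J) (ed : J -> {set 'I_n})
    (c : J -> {set {set 'I_n}} -> R) (b : J -> R) (V l : R) :
  uniq (map ed s) -> {in s, forall j, ed j \in vpairs n} ->
  {in s &, forall i j G, c i (flip (ed j) G) = c i G} ->
  {in s, forall j G, c j G ^+ 2 <= b j} ->
  \sum_(j <- s) b j <= V -> 0 < V -> 0 <= l ->
  Gavg (fun G => (l < `|\sum_(j <- s) c j G * esign (ed j) G|)%R%:R) <= 2 * expR (- (l ^+ 2 / (8 * V))).
Proof.
move=> us vs cs bs bV V0 l0; have [t tE] : exists t, t = l / (4 * V) by eexists.
have t0 : 0 <= t by rewrite tE divr_ge0 // mulr_ge0 // ltW.
pose Y G := \sum_(j <- s) c j G * esign (ed j) G.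
have one (a : R) : a ^+ 2 = 1 -> Gavg (fun G => expR (t * a * Y G - t * l)) <= expR (- (l ^+ 2 / (8 * V))).
  move=> a1.
  have -> : Gavg (fun G => expR (t * a * Y G - t * l)) =
      expR (- (t * l)) * Gavg (fun G => expR (\sum_(j <- s) (t * a * c j G) * esign (ed j) G)).
    rewrite -GavgZ; congr Gavg; apply: funext => G.
    rewrite -expRD addrC /Y mulr_sumr; congr (expR (_ + _)).
    by apply: eq_bigr => j _; rewrite mulrA.
  apply: (@le_trans _ _ (expR (- (t * l)) * expR (2 * \sum_(j <- s) t ^+ 2 * b j))).
    rewrite ler_wpM2l ?expR_ge0 //; apply: mgf_le => //.
      by move=> i j si sj G; rewrite cs.
    by move=> j sj G; rewrite !exprMn a1 mulr1; apply: ler_wpM2l; [exact: sqr_ge0|exact: bs].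
  rewrite -expRD ler_expR -mulr_sumr.
  apply: (@le_trans _ _ (- (t * l) + 2 * (t ^+ 2 * V))).
    by rewrite lerD2l ler_wpM2l // ler_wpM2l // sqr_ge0.
  by rewrite le_eqVlt; apply/orP; left; apply/eqP; rewrite tE; field; rewrite gt_eqF.
apply: (@le_trans _ _ (Gavg (fun G => expR (t * 1 * Y G - t * l) + expR (t * (-1) * Y G - t * l)))).
  apply: Gavg_le => G; rewrite -/(Y G).
  have e1 := expR_gt0 (t * 1 * Y G - t * l).
  have e2 := expR_gt0 (t * (-1) * Y G - t * l).
  case: (ltP l `|Y G|) => [lY|_] /=; last by apply: ltW; apply: addr_gt0.
  have [Y0|Y0] := leP 0 (Y G).
    rewrite (ger0_norm Y0) in lY.
    have : 1 <= expR (t * 1 * Y G - t * l) by rewrite -[leLHS]expR0 ler_expR mulr1 -mulrBr mulr_ge0 // subr_ge0 ltW.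
    lra.
  rewrite (ltr0_norm Y0) in lY.
  have : 1 <= expR (t * (-1) * Y G - t * l).
    by rewrite -[leLHS]expR0 ler_expR mulrN1 mulNr -mulrN -mulrBr mulr_ge0 // subr_ge0 ltW.
  lra.
rewrite GavgD mulr_natl mulr2n lerD //; apply: one; by rewrite ?sqrrN expr1n.
Qed.

Lemma union_le (J : finType) (P : pred J) (A : J -> {set {set 'I_n}} -> bool) (B : pred {set {set 'I_n}}) (p : R) :
  (forall G, B G -> exists2 j, P j & A j G) ->
  (forall j, P j -> Gavg (fun G => (A j G)%:R) <= p) ->
  Gavg (fun G => (B G)%:R) <= #|P|%:R * p.
Proof.
move=> BA Ap; apply: (@le_trans _ _ (Gavg (fun G => \sum_(j | P j) (A j G)%:R))).
  apply: Gavg_le => G; case: (boolP (B G)) => [/BA[j Pj Aj]|_]; last by rewrite sumr_ge0.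
  by rewrite (bigD1 j) //= Aj lerDl sumr_ge0.
rewrite Gavg_sum mulr_natl -sumr_const; exact: ler_sum.
Qed.

End RandomGraph.

(** * Probability of the two graph properties *)

Lemma card_small_sets (n d : nat) : (1 < n)%N -> (#|[set S : {set 'I_n} | (#|S| < d)%N]| <= n ^ d)%N.
Proof.
move=> n1; elim: d => [|d IH].
  by rewrite (_ : [set _ | _] = set0) ?cards0 //; apply/setP => S; rewrite !inE.
apply: (@leq_trans (#|[set S : {set 'I_n} | (#|S| < d)%N]| + #|[set S : {set 'I_n} | #|S| == d]|)).
  apply: leq_trans (leq_card_setU _ _); apply: subset_leq_card; apply/subsetP => S.
  by rewrite !inE ltnS leq_eqVlt orbC.
have := card_draws_le 'I_n d; rewrite card_ord => h.
apply: leq_trans (leq_add IH h) _; rewrite addnn -mul2n expnS leq_mul2r n1 orbT //.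
Qed.

Section Events.
Variables (R : realType) (n : nat).

Lemma set2_vpairs (u v : 'I_n) : u != v -> [set u; v] \in vpairs n.
Proof. by rewrite inE cards2 => ->. Qed.

(** Union bound over the pairs [(S, s)]. As [s] is outside [S], membership in [nbrs G S] does not
    depend on the pairs containing [s] that are summed over, so [tail_le] applies with variance
    [n]. *)
Lemma nbr_balanced_prob (d : nat) (x : R) : 0 <= x -> (1 < n)%N ->
  Gavg (fun G : {set {set 'I_n}} => (~~ `[< nbr_balanced G d x >])%:R) <=
    (n ^ d.+1)%:R * (2 * expR (- (x ^+ 2 / (8 * n%:R)))).
Proof.
move=> x0 n1.
pose P := [pred p : {set 'I_n} * 'I_n | (#|p.1| < d)%N && (p.2 \notin p.1)].
pose A (p : {set 'I_n} * 'I_n) G := x < `|\sum_(v in nbrs G p.1) chi G R v p.2|.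
apply: le_trans (_ : #|P|%:R * (2 * expR (- (x ^+ 2 / (8 * n%:R)))) <= _); last first.
  rewrite ler_wpM2r ?mulr_ge0 ?expR_ge0 // ler_nat expnSr.
  apply: (@leq_trans #|setX [set S : {set 'I_n} | (#|S| < d)%N] [set: 'I_n]|).
    by apply: subset_leq_card; apply/subsetP => -[S s]; rewrite !inE /= => /andP[-> _].
  by rewrite cardsX cardsT card_ord leq_mul2r card_small_sets ?orbT.
apply: (@union_le R n _ P A).
  move=> G; apply: contraNP => noA; apply/asboolP => S s Sd sS.
  by rewrite leNgt; apply/negP => xS; apply: noA; exists (S, s) => //=; rewrite Sd sS.
move=> [S s] /= /andP[_ sS]; rewrite /A /=.
pose e := enum [pred v : 'I_n | v != s].
have es v : v \in e -> v != s by rewrite mem_enum.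
have -> : (fun G => (x < `|\sum_(v in nbrs G S) chi G R v s|)%R%:R : R) =
  (fun G => (x < `|\sum_(v <- e) (v \in nbrs G S)%:R * esign R [set v; s] G|)%R%:R).
  apply: funext => G; congr (x < `|_|)%R%:R.
  rewrite /e big_enum /= big_mkcond [RHS]big_mkcond; apply: eq_bigr => v _.
  rewrite /chi /esign (_ : (v \in [pred v | v != s]) = (v != s)) //=.
  by case: (v == s); case: (v \in nbrs G S); rewrite /= ?mul1r ?mul0r.
apply: (@tail_le R n _ e (fun v => [set v; s]) (fun v G => (v \in nbrs G S)%:R)
  (fun=> 1)) => //.
- rewrite map_inj_in_uniq ?enum_uniq // => u v /es us /es vs /setP/(_ u).
  by rewrite !inE eqxx (negPf us) /= orbF => /esym/eqP.
- by move=> v /es; apply: set2_vpairs.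
- move=> v w /es vs /es ws G /=; congr (_%:R); congr (nat_of_bool _); rewrite !inE.
  apply: eq_forallb_in => s' s'S; congr (_ && _).
  have ss : s' != s by apply: contraNneq sS => <-.
  apply: in_flip; apply: contraNneq vs => /setP/(_ s).
  by rewrite !inE eqxx orbT ![s == _]eq_sym (negPf ss) orbF.
- by move=> v _ G; case: (_ \in _); rewrite /= ?expr1n ?expr0n ?ler01.
- rewrite big_const_seq iter_addr_0.
  rewrite ler_nat (leq_trans (count_size _ _)) // -cardE.
  by apply: leq_trans (max_card _) _; rewrite card_ord.
- by rewrite ltr0n; apply: ltnW.
Qed.

(** The symmetric form counts each edge twice; the part above the diagonal has one independent sign
    per term. *)
Definition half_form (a b : 'I_n -> R) (G : {set {set 'I_n}}) : R :=
  \sum_(p : 'I_n * 'I_n | (p.1 < p.2)%N) a p.1 * b p.2 * esign R [set p.1; p.2] G.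

Lemma chi_formE (a b : 'I_n -> R) (G : {set {set 'I_n}}) :
  \sum_i \sum_j a i * b j * chi G R i j = half_form a b G + half_form b a G.
Proof.
rewrite pair_big /= /half_form.
rewrite (bigID (fun p : 'I_n * 'I_n => (p.1 < p.2)%N)) /=; congr (_ + _).
  apply: eq_bigr => -[i j] /= ij; rewrite /chi /esign.
  by rewrite -val_eqE /= (ltn_eqF ij).
rewrite (bigID (fun p : 'I_n * 'I_n => p.1 == p.2)) /= big1 ?add0r; last first.
  by move=> [i j] /= /andP[_ /eqP->]; rewrite /chi eqxx mulr0.
rewrite (reindex (fun p : 'I_n * 'I_n => (p.2, p.1))) /=; last by exists (fun p => (p.2, p.1)) => -[].
apply: eq_big => [[i j]|[i j]] /=.
  by rewrite -leqNgt -val_eqE /= eq_sym ltn_neqAle andbC.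
rewrite -leqNgt => /andP[ij ji]; rewrite /chi /esign (negPf ji) setUC.
by rewrite [X in X * _]mulrC.
Qed.

Lemma half_formBl (a a' b : 'I_n -> R) G :
  half_form (fun i => a i - a' i) b G = half_form a b G - half_form a' b G.
Proof. by rewrite /half_form -sumrB; apply: eq_bigr => p _; rewrite !mulrBl. Qed.

Lemma half_formBr (a b b' : 'I_n -> R) G :
  half_form a (fun i => b i - b' i) G = half_form a b G - half_form a b' G.
Proof. by rewrite /half_form -sumrB; apply: eq_bigr => p _; rewrite mulrBr mulrBl. Qed.

Lemma half_formZ c (a b : 'I_n -> R) G :
  half_form (fun i => c * a i) (fun i => c * b i) G = c ^+ 2 * half_form a b G.
Proof. by rewrite /half_form mulr_sumr; apply: eq_bigr => p _; ring. Qed.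

Lemma half_form_trivial (s t : R) (a b : 'I_n -> R) G :
  (forall i, `|a i| <= s) -> (forall i, `|b i| <= t) -> 0 <= s -> 0 <= t ->
  `|half_form a b G| <= (n ^ 2)%:R * (s * t).
Proof.
move=> sa tb s0 t0; apply: (le_trans (ler_norm_sum _ _ _)).
rewrite big_mkcond (_ : (n ^ 2)%N = #|{: 'I_n * 'I_n}|); last by rewrite card_prod card_ord mulnn.
rewrite mulr_natl -sumr_const; apply: ler_sum => p _; case: ifP => _; last by rewrite mulr_ge0.
rewrite !normrM (_ : `|esign R _ G| = 1) ?mulr1 ?ler_pM //.
by rewrite /esign; case: ifP; rewrite ?normrN normr1.
Qed.

(* The mesh [1 / n ^ 2] is so fine that rounding changes a bilinear form with
   entries bounded by 1 by a constant only. *)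
Definition grid (j : 'I_(2 * n ^ 2).+1) : R := (j%:R - (n ^ 2)%:R) / (n ^ 2)%:R.

(** The bound 4 on the squared norm leaves room for the rounding of unit vectors. *)
Definition half_form_net (l : R) (G : {set {set 'I_n}}) : Prop :=
  forall a b : {ffun 'I_n -> 'I_(2 * n ^ 2).+1},
    \sum_i grid (a i) ^+ 2 <= 4 -> \sum_i grid (b i) ^+ 2 <= 4 ->
    `|half_form (grid \o a) (grid \o b) G| <= l.

(** Union bound over all pairs of grid vectors. The variance is at most [4 * 4 = 16], whence
    [128 = 8 * 16]. *)
Lemma half_form_net_prob (l : R) : 0 <= l ->
  Gavg (fun G : {set {set 'I_n}} => (~~ `[< half_form_net l G >])%:R) <=
    (((2 * n ^ 2).+1 ^ n) ^ 2)%:R * (2 * expR (- (l ^+ 2 / 128))).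
Proof.
move=> l0.
pose T := {ffun 'I_n -> 'I_(2 * n ^ 2).+1}.
pose P := [pred p : T * T | (\sum_i grid (p.1 i) ^+ 2 <= 4) && (\sum_i grid (p.2 i) ^+ 2 <= 4)].
pose A (p : T * T) G := l < `|half_form (grid \o p.1) (grid \o p.2) G|.
apply: le_trans (_ : #|P|%:R * (2 * expR (- (l ^+ 2 / 128))) <= _); last first.
  rewrite ler_wpM2r ?mulr_ge0 ?expR_ge0 // ler_nat.
  by apply: leq_trans (max_card _) _; rewrite card_prod card_ffun !card_ord mulnn.
apply: (@union_le R n _ P A).
  move=> G; apply: contraNP => noA; apply/asboolP => a b a4 b4.
  by rewrite leNgt; apply/negP => xS; apply: noA; exists (a, b) => //=; rewrite a4 b4.
move=> [a b] /andP[/= a4 b4]; rewrite /A /half_form /=.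
pose e := enum [pred p : 'I_n * 'I_n | (p.1 < p.2)%N].
have ee p : p \in e -> (p.1 < p.2)%N by rewrite mem_enum.
under [X in Gavg X]funext => G do rewrite -big_enum.
rewrite (_ : 128 = 8 * 16); last by ring.
apply: (@tail_le R n _ e (fun p => [set p.1; p.2]) (fun p G => grid (a p.1) * grid (b p.2))
   (fun p => grid (a p.1) ^+ 2 * grid (b p.2) ^+ 2)) => //.
- rewrite map_inj_in_uniq ?enum_uniq // => -[u v] [u' v'] /ee /= uv /ee /= uv' /setP eq_uv.
  have hu : (u == u') || (u == v') by have := eq_uv u; rewrite !inE eqxx => <-.
  have hv : (v == u') || (v == v') by have := eq_uv v; rewrite !inE eqxx orbT => <-.
  case/orP: hu => /eqP hu; case/orP: hv => /eqP hv; rewrite hu hv ?ltnn // in uv *.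
  by have := ltn_trans uv uv'; rewrite ltnn.
- by move=> p /ee pp; apply: set2_vpairs; rewrite -val_eqE /= ltn_eqF.
- by move=> p _ G; rewrite exprMn.
rewrite big_enum /=; apply: (@le_trans _ _ (\sum_(p : 'I_n * 'I_n) grid (a p.1) ^+ 2 * grid (b p.2) ^+ 2)).
  rewrite [leLHS]big_mkcond; apply: ler_sum => p _; case: ifP => // _.
  by rewrite mulr_ge0 ?sqr_ge0.
rewrite -(pair_big predT predT (fun i j => grid (a i) ^+ 2 * grid (b j) ^+ 2)) /=.
rewrite -big_distrlr; have -> : 16 = 4 * 4 :> R by ring.
by rewrite ler_pM // sumr_ge0 // => i _; rewrite sqr_ge0.
Qed.

Lemma grid_norm j : `|grid j| <= 1.
Proof.
have := ltn_ord j; rewrite /grid normrM normfV.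
move: (nat_of_ord j) => m; case: (posnP n) => [->|n0] jn.
  by rewrite exp0n // normr0 invr0 mulr0 ler01.
rewrite ler_pdivrMr ?normr_gt0 ?pnatr_eq0 -?lt0n ?expn_gt0 ?n0 // mul1r (ger0_norm (ler0n _ _)).
move: jn; rewrite ltnS -(ler_nat R) [leRHS]natrM => jn.
have := ler0n R m; rewrite ler_norml; lra.
Qed.

Lemma grid_approx (t : R) : (0 < n)%N -> `|t| <= 1 -> exists j, `|t - grid j| <= ((n ^ 2)%:R)^-1.
Proof.
move=> n0; rewrite ler_norml => /andP[t1 t2].
have N0 : 0 < (n ^ 2)%:R :> R by rewrite ltr0n expn_gt0 n0.
pose m := Num.truncn ((t + 1) * (n ^ 2)%:R).
have tN : 0 <= (t + 1) * (n ^ 2)%:R by rewrite mulr_ge0 ?(ltW N0) //; lra.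
have /andP[m1 m2] := truncn_itv tN; rewrite -/m in m1 m2.
have mN : (m < (2 * n ^ 2).+1)%N.
  rewrite ltnS -(ler_nat R) (le_trans m1) // [leRHS]natrM ler_wpM2r ?(ltW N0) //; lra.
exists (Ordinal mN); rewrite /grid /=.
have -> : t - (m%:R - (n ^ 2)%:R) / (n ^ 2)%:R = ((t + 1) * (n ^ 2)%:R - m%:R) / (n ^ 2)%:R.
  by field; rewrite pnatr_eq0 -lt0n ?expn_gt0 ?n0.
rewrite normrM normfV (ger0_norm (ltW N0)) ler_piMl ?invr_ge0 ?(ltW N0) //.
by rewrite -natr1 in m2; rewrite ler_norml; lra.
Qed.

(** Round [a], then [b]: each rounding changes the form by at most [n ^ 2] terms of size
    [1 / n ^ 2], that is, by 1. *)
Lemma half_form_net_le (l : R) G : (0 < n)%N -> half_form_net l G ->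
  forall a b : 'I_n -> R, \sum_i a i ^+ 2 <= 1 -> \sum_i b i ^+ 2 <= 1 ->
  `|half_form a b G| <= l + 2.
Proof.
move=> n0 net a b a1 b1.
have N1 : 1 <= (n ^ 2)%:R :> R by rewrite ler1n expn_gt0 n0.
have nN : n%:R * ((n ^ 2)%:R)^-1 ^+ 2 <= 1 :> R.
  rewrite exprVn ler_pdivrMr ?mul1r ?exprn_gt0 ?(lt_le_trans ltr01) //.
  by rewrite -natrX ler_nat -expnM; case: n n0 => // m _; rewrite expnS leq_pmulr // expn_gt0.
have small (c : 'I_n -> R) : \sum_i c i ^+ 2 <= 1 -> forall i, `|c i| <= 1.
  move=> c1 i; rewrite -(@ler_pXn2r _ 2) ?nnegrE // expr1n real_normK ?num_real //.
  by apply: le_trans c1; rewrite (bigD1 i) //= lerDl sumr_ge0 // => j _; apply: sqr_ge0.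
have approx (c : 'I_n -> R) : \sum_i c i ^+ 2 <= 1 ->
    exists2 c' : {ffun 'I_n -> 'I_(2 * n ^ 2).+1},
      forall i, `|c i - grid (c' i)| <= ((n ^ 2)%:R)^-1 & \sum_i grid (c' i) ^+ 2 <= 4.
  move=> c1; have [c' Hc'] := choice (fun i => grid_approx n0 (small c c1 i)).
  exists [ffun i => c' i]; first by move=> i; rewrite ffunE.
  (* With [g] the rounded entry, [g ^ 2 <= 2 c ^ 2 + 2 (c - g) ^ 2] is [(2 c - g) ^ 2 >= 0]
     rearranged. *)
  apply: (@le_trans _ _ (\sum_i (2 * c i ^+ 2 + 2 * (n ^ 2)%:R^-1 ^+ 2))).
    apply: ler_sum => i _; rewrite ffunE.
    have h : (c i - grid (c' i)) ^+ 2 <= (n ^ 2)%:R^-1 ^+ 2.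
      by rewrite -[leLHS]real_normK ?num_real // ler_pXn2r ?nnegrE // invr_ge0.
    have := sqr_ge0 (2 * c i - grid (c' i)); lra.
  rewrite big_split /= -!mulr_sumr sumr_const card_ord -mulr_natl; lra.
have [a' a'1 a'2] := approx a a1; have [b' b'1 b'2] := approx b b1.
have -> : half_form a b G = half_form (grid \o a') (grid \o b') G +
   (half_form (fun i => a i - grid (a' i)) b G +
    half_form (grid \o a') (fun i => b i - grid (b' i)) G).
  by rewrite half_formBl half_formBr; ring.
apply: (le_trans (ler_normD _ _)); apply: lerD; first exact: net.
apply: (le_trans (ler_normD _ _)); rewrite -[2]/(1 + 1).
have N0 : (n ^ 2)%:R != 0 :> R by rewrite gt_eqF // (lt_le_trans ltr01).
apply: lerD.
  apply: le_trans (half_form_trivial _ a'1 (small b b1) _ _) _; rewrite ?invr_ge0 //.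
  by rewrite mulr1 mulfV.
apply: le_trans (half_form_trivial _ (fun i => grid_norm (a' i)) b'1 _ _) _; rewrite ?invr_ge0 //.
by rewrite mul1r mulfV.
Qed.

(** Both vectors are divided by the square root of [M], which brings them into the unit ball; the
    factor 2 counts the two triangles of [chi]. *)
Lemma chi_form_le_net (l : R) (G : {set {set 'I_n}}) : (0 < n)%N -> 0 <= l -> half_form_net l G ->
  chi_form_le G (2 * (l + 2)).
Proof.
move=> n0 l0 net u w; rewrite chi_formE.
set M := \sum_i u i ^+ 2 + _.
have hf (a b : 'I_n -> R) : \sum_i a i ^+ 2 <= M -> \sum_i b i ^+ 2 <= M ->
    `|half_form a b G| <= (l + 2) * M.
  move=> aM bM.
  have M0 : 0 <= M by apply: le_trans aM; apply: sumr_ge0 => i _; apply: sqr_ge0.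
  have [M_eq0|M_neq0] := eqVneq M 0.
    have a0 i : a i = 0.
      apply/eqP; rewrite -sqrf_eq0 eq_le sqr_ge0 andbT -M_eq0; apply: le_trans aM.
      by rewrite (bigD1 i) //= lerDl sumr_ge0 // => j _; apply: sqr_ge0.
    by rewrite M_eq0 mulr0 /half_form big1 ?normr0 // => p _; rewrite a0 !mul0r.
  have M_gt0 : 0 < M by rewrite lt0r M_neq0.
  pose c := Num.sqrt M; have c2 : c ^+ 2 = M by rewrite sqr_sqrtr.
  have c0 : c != 0 by rewrite sqrtr_eq0 -ltNge.
  have sc (d : 'I_n -> R) : \sum_i d i ^+ 2 <= M -> \sum_i (c^-1 * d i) ^+ 2 <= 1.
    move=> dM; under eq_bigr => i _ do rewrite exprMn.
    by rewrite -mulr_sumr exprVn c2 mulrC ler_pdivrMr // mul1r.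
  have := half_form_net_le n0 net (sc a aM) (sc b bM).
  rewrite half_formZ exprVn c2 normrM (ger0_norm (_ : 0 <= M^-1)) ?invr_ge0 //.
  by rewrite mulrC ler_pdivrMr.
have u0 : 0 <= \sum_i u i ^+ 2 by apply: sumr_ge0 => i _; apply: sqr_ge0.
have w0 : 0 <= \sum_i w i ^+ 2 by apply: sumr_ge0 => i _; apply: sqr_ge0.
have uM : \sum_i u i ^+ 2 <= M by rewrite /M lerDl.
have wM : \sum_i w i ^+ 2 <= M by rewrite /M lerDr.
apply: (le_trans (ler_normD _ _)).
by rewrite -mulrA mulr_natl mulr2n lerD // hf.
Qed.

End Events.

Local Open Scope classical_set_scope.
Local Open Scope ring_scope.

(** * Asymptotics *)

Lemma expR1_le4 (R : realType) : expR (1 : R) <= 4.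
Proof.
have h : 1 / 2 <= expR (- (1 / 2) : R) by apply: le_trans (expR_ge1Dx _); lra.
have e : expR (1 : R) = (expR (- (1 / 2)))^-1 ^+ 2.
  by rewrite -expRN opprK -expRM_natl; congr expR; field.
rewrite e exprVn -[4]invrK lef_pV2 ?posrE ?invr_gt0 ?exprn_gt0 ?expR_gt0 //.
nra.
Qed.

Section Asymptotics.
Variables (R : realType) (n : nat).
Hypothesis n_ge4 : (4 <= n)%N.
Let L : R := ln n%:R.
Let s : R := Num.sqrt n%:R * L.

Let n_gt0 : 0 < n%:R :> R. Proof. by rewrite ltr0n; apply: leq_trans n_ge4. Qed.

Let expL : expR L = n%:R. Proof. by rewrite lnK. Qed.

Let L_ge1 : 1 <= L.
Proof.
by rewrite -ler_expR expL (le_trans (expR1_le4 R)) // ler_nat.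
Qed.

Let s_ge1 : 1 <= s.
Proof.
rewrite mulr_ege1 // -[leLHS]sqrtr1 ler_wsqrtr // ler1n.
by apply: leq_trans n_ge4.
Qed.

Let s_sqr : s ^+ 2 = n%:R * L ^+ 2.
Proof. by rewrite exprMn sqr_sqrtr // ltW. Qed.

Let natX_expR (p : nat) : (n ^ p)%:R = expR (p%:R * L) :> R.
Proof. by rewrite natrX -expL expRM_natl. Qed.

Let expRNL : expR (- L) = n%:R^-1.
Proof. by rewrite expRN expL. Qed.

(** With [2 r <= L] the union bound costs at most [expR ((L + 1) * L)], against a tail of
    [expR (- 2178 * L ^ 2)]. The value 132 is the one needed for the form of [chi]:
    [2 * (64 s + 2) <= 132 s]. *)
Lemma nbr_balanced_fail (r : nat) : (2 * r)%:R <= L ->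
  Gavg (fun G : {set {set 'I_n}} => (~~ `[< nbr_balanced G (2 * r) (132 * s)  >])%:R) <= 2 / n%:R :> R.
Proof.
move=> rL; apply: le_trans (nbr_balanced_prob _ _ _) _.
- by rewrite mulr_ge0 // (le_trans _ s_ge1).
- by apply: leq_trans n_ge4.
rewrite natX_expR mulrCA -expRD ler_wpM2l // -expRNL ler_expR -natr1 exprMn s_sqr.
have -> : 132 ^+ 2 * (n%:R * L ^+ 2) / (8 * n%:R) = 2178 * L ^+ 2.
  by field; rewrite gt_eqF.
have L2 : L <= L ^+ 2 by rewrite expr2 ler_peMl // (le_trans _ L_ge1).
have : ((2 * r)%:R + 1) * L <= (L + 1) * L.
  by rewrite ler_wpM2r ?lerD2r // (le_trans _ L_ge1).
have : 0 <= L ^+ 2 by apply: sqr_ge0.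
lra.
Qed.

(** The net has at most [n ^ (6 n)] pairs because [2 n ^ 2 + 1 <= n ^ 3]; the tail
    [expR (- 32 n L ^ 2)] outweighs it. *)
Lemma half_form_net_fail :
  Gavg (fun G : {set {set 'I_n}} => (~~ `[< half_form_net (64 * s) G  >])%:R) <= 2 / n%:R :> R.
Proof.
apply: le_trans (half_form_net_prob _ _) _.
  by rewrite mulr_ge0 // (le_trans _ s_ge1).
apply: (@le_trans _ _ ((n ^ (6 * n))%:R * (2 * expR (- ((64 * s) ^+ 2 / 128))))).
  rewrite ler_wpM2r ?mulr_ge0 ?expR_ge0 // ler_nat -expnM.
  rewrite (_ : (6 * n = 3 * (n * 2))%N); last by lia.
  rewrite [leqRHS]expnM leq_exp2r; last by move: n_ge4; lia.
  by move: n_ge4; case: n => // m; rewrite !expnS expn0; nia.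
rewrite natX_expR mulrCA -expRD ler_wpM2l // -expRNL ler_expR exprMn s_sqr natrM.
have -> : 64 ^+ 2 * (n%:R * L ^+ 2) / 128 = 32 * (n%:R * L ^+ 2) by field.
have L2 : L <= L ^+ 2 by rewrite expr2 ler_peMl // (le_trans _ L_ge1).
have h1 : n%:R * L <= n%:R * L ^+ 2 by rewrite ler_wpM2l // ltW.
have h2 : L <= n%:R * L.
  rewrite ler_peMl ?(le_trans _ L_ge1) // ler1n.
  by apply: leq_trans n_ge4.
have : 0 <= L by apply: le_trans L_ge1.
lra.
Qed.

(** The [r]-th power of the hypothesis: the exponents [1 / (2 r)] and [1 / r] become 1/2 and 1. *)
Lemma clique_size_bound (C : R) (r k : nat) : 0 < C -> (0 < r)%N ->
  k%:R <= n%:R `^ (2 * r)%:R^-1 / (C ^+ r * L `^ r%:R^-1) ->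
  k%:R ^+ r * C ^+ (r ^ 2) * L <= Num.sqrt n%:R.
Proof.
move=> C0 r0 hk.
have L0 : 0 < L by apply: lt_le_trans L_ge1.
have rr : r%:R != 0 :> R by rewrite pnatr_eq0 -lt0n.
have den0 : 0 < C ^+ r * L `^ r%:R^-1 by rewrite mulr_gt0 ?exprn_gt0 ?powR_gt0.
have e1 : (n%:R `^ (2 * r)%:R^-1) ^+ r = Num.sqrt n%:R :> R.
  rewrite -powR_mulrn ?powR_ge0 // -powRrM -powR12_sqrt ?(ltW n_gt0) //.
  by congr (_ `^ _); rewrite natrM; field.
have e2 : (L `^ r%:R^-1) ^+ r = L.
  by rewrite -powR_mulrn ?powR_ge0 // -powRrM mulVf // powRr1 // ltW.
move: hk; rewrite ler_pdivlMr // => hk.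
have := @lerXn2r R r _ _ _ _ hk; rewrite !nnegrE => /(_ _ _).
rewrite e1 !exprMn e2 -exprM mulnn mulrA; apply; last exact: powR_ge0.
by rewrite mulr_ge0 // ltW.
Qed.

Lemma no_refutation_prob (r : nat) : (0 < r)%N ->
  1 - 4 / n%:R <= Gnp_prob (n := n) (1 / 2 : R) (fun G =>
    forall k : nat,
      k%:R <= n%:R `^ (2 * r)%:R^-1 / ((132 * 1024) ^+ r * ln (n%:R : R) `^ r%:R^-1) ->
      ~ PS_refutation r (Clique R G k)).
Proof.
move=> r0; set A := (X in Gnp_prob _ X); rewrite Gnp_prob_half.
have L0 : 0 < L by apply: lt_le_trans L_ge1.
have n0 : (0 < n)%N by apply: leq_trans n_ge4.
have C0 : 0 < 132 * 1024 :> R by lra.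
(* For [2 r > ln n] the size bound leaves only [k = 0]: any [k >= 1] would give
   [expR r <= C ^ (r ^ 2) <= sqrt n], that is, [2 r <= ln n]. *)
have [rL|Lr] := leP (2 * r)%:R L; last first.
  rewrite -[leLHS](Gavg_cst n); apply: Gavg_le => G.
  rewrite (_ : `[< A G >] = true) /=; first by rewrite gerBl divr_ge0.
  apply/asboolP => k /(clique_size_bound C0 r0) hk.
  have [k_eq0|k_gt0] := posnP k.
    rewrite k_eq0 -(cards0 'I_n); apply: clique_no_refutation => //.
    by apply/cliqueP => u v; rewrite inE.
  suff : (2 * r)%:R <= L by rewrite leNgt Lr.
  rewrite -ler_expR expL -[n%:R]sqr_sqrtr ?(ltW n_gt0) //.
  have k1 : 1 <= k%:R ^+ r :> R by rewrite exprn_ege1 // ler1n.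
  have Ck : (132 * 1024) ^+ (r ^ 2) <= Num.sqrt n%:R :> R.
    apply: le_trans hk; rewrite mulrAC [leRHS]mulrC ler_peMr ?exprn_ge0 ?(ltW C0) //.
    by rewrite mulr_ege1.
  have e4 : expR (r%:R : R) <= (132 * 1024) ^+ (r ^ 2).
    rewrite -[r%:R]mulr1 expRM_natl.
    apply: (@le_trans _ _ (4 ^+ r)); first by rewrite lerXn2r ?nnegrE ?expR_ge0 ?expR1_le4.
    apply: (@le_trans _ _ (4 ^+ (r ^ 2))); first by rewrite ler_weXn2l ?ler1n // -mulnn leq_pmulr.
    by rewrite lerXn2r ?nnegrE //; lra.
  rewrite natrM expRM_natl lerXn2r ?nnegrE ?expR_ge0 ?sqrtr_ge0 //.
  exact: le_trans e4 Ck.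
have key : Gavg (fun _ : {set {set 'I_n}} => 1) <= Gavg (fun G : {set {set 'I_n}} => (`[< A G >])%:R +
    ((~~ `[< nbr_balanced G (2 * r) (132 * s) >])%:R +
     (~~ `[< half_form_net (64 * s) G >])%:R)) :> R.
  apply: Gavg_le => G; case: asboolP => [_|nA]; first by rewrite lerDl addr_ge0.
  case: asboolP => [bal|_] /=; last by rewrite add0r lerDl.
  case: asboolP => [net|_] /=; last by rewrite !add0r.
  case: nA => k /(clique_size_bound C0 r0) hk.
  have s0 : 0 <= s by apply: le_trans s_ge1.
  apply: (@balanced_no_refutation R n G k r (132 * s)) => //.
  - by move: s_ge1; lra.
  - have := chi_form_le_net n0 _ net => /(_ _) cf u w; apply: le_trans (cf _ u w) _.
      by rewrite mulr_ge0.
    rewrite ler_wpM2r ?addr_ge0 ?sumr_ge0 // => [i _|i _|]; rewrite ?sqr_ge0 //.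
    by move: s_ge1; lra.
  (* One factor [sqrt n] pays for the one inside [s], the other bounds the rest; the factor 132 in
     [x] is covered by [132 ^ (r ^ 2)]. *)
  - apply: (@le_trans _ _ (Num.sqrt n%:R * (k%:R ^+ r * (132 * 1024) ^+ (r ^ 2) * L))); last first.
      rewrite -[leRHS](sqr_sqrtr (ltW n_gt0)) expr2 ler_wpM2l ?sqrtr_ge0 //.
    rewrite [leRHS](_ : _ = 132 ^+ (r ^ 2) * (s * k%:R ^+ r * 1024 ^+ (r ^ 2))); last first.
      by rewrite /s exprMn; ring.
    rewrite -!mulrA ler_wpM2r ?mulr_ge0 ?mulr_ge0 ?exprn_ge0 ?sqrtr_ge0 ?(ltW L0) //.
    by rewrite -[leLHS]expr1 ler_weXn2l ?ler1n // expn_gt0 r0.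
have e : 4 / n%:R = 2 / n%:R + 2 / n%:R :> R by rewrite -mulrDl; congr (_ / _); ring.
move: key; rewrite !GavgD Gavg_cst e.
have := nbr_balanced_fail rL; have := half_form_net_fail; lra.
Qed.

End Asymptotics.

(** The failure probability [4 / n] is independent of [r], so [r] may vary with [n]. *)
Theorem mainTheorem3 (R : realType) :
  exists C : R, 0 < C /\
    forall r : nat -> nat, (forall n, (0 < r n)%N) ->
      Gnp_prob (n := n) (1 / 2 : R) (fun G =>
        forall k : nat,
          k%:R <= n%:R `^ (2 * r n)%:R^-1
                  / (C ^+ r n * ln (n%:R : R) `^ (r n)%:R^-1) ->
          ~ PS_refutation (r n) (Clique R G k))
      @[n --> \oo] --> (1 : R).
Proof.
exists (132 * 1024); split=> [|r r0]; first by lra.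
(* [harmonic n] is [1 / (n + 1)], and [4 / n <= 8 / (n + 1)] for [n >= 1]. *)
have lower : (fun n => 1 - 8 * harmonic n) @ \oo --> (1 : R).
  rewrite -[X in _ --> X](_ : 1 - 8 * 0 = 1); last by rewrite mulr0 subr0.
  by apply: cvgB; [exact: cvg_cst|apply: cvgMr; exact: cvg_harmonic].
apply: (squeeze_cvgr _ lower (cvg_cst _)).
near=> n.
have n4 : (4 <= n)%N by near: n; exact: nbhs_infty_ge.
apply/andP; split; last first.
  rewrite Gnp_prob_half -[leRHS](Gavg_cst n); apply: Gavg_le => G.
  by case: asboolP => _; rewrite ?ler01.
apply: le_trans (no_refutation_prob R n4 (r0 n)).
rewrite lerD2l lerN2 /harmonic ler_pdivrMr ?ltr0n; last by lia.
rewrite mulrAC ler_pdivlMr ?ltr0n // -natr1.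
have : 4 <= n%:R :> R by rewrite ler_nat.
lra.
Unshelve. all: by end_near.
Qed.
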